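(* There exist $\gamma,\delta>0$ with the following property. If $K\in\mathcal{F}_0^2$ satisfies $\mathcal{R}_{-2}(K)\leq 1+\delta$, then $$(d_{\mathcal{BM}}(K,B)-1)^4\leq \gamma\left(\mathcal{R}_{-2}(K)-1\right).$$ If $K\in\mathcal{F}_0^2$ satisfies $\mathcal{R}_{-2}(K)\leq 1+\delta$ and has its Santaló point at the origin, then $$(d_{\mathcal{BM}}(K,B)-1)^4\leq \gamma\left(\sqrt{\mathcal{R}_{-2}(K)}-1\right).$$ Moreover, if $K\in\mathcal{F}_0^2$ is origin-symmetric, then $$d_{\mathcal{BM}}(K,B)\leq \sqrt{\mathcal{R}_{-2}(K)},$$ and in this origin-symmetric case no upper bound on $\mathcal{R}_{-2}(K)$ is required (that is, one may take $\delta=\infty$).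
   Context: A convex body in $\mathbb{R}^n$ is a compact convex set with non-empty interior; here $n=2$. $\mathcal{F}_0^2$ is the set of smooth, strictly convex bodies in $\mathbb{R}^2$ that contain the origin in their interior; here smooth, strictly convex means that the boundary is a $C^\infty$ curve with everywhere positive curvature. $B$ is the closed unit disc, $S^1$ the unit circle, $V$ the Lebesgue measure on $\mathbb{R}^2$. Origin-symmetric means $K=-K$. The support function is $h_K(u)=\max_{x\in K}x\cdot u$, $u\in S^{1}$, and the curvature function is $f_K=h_K''+h_K$ (derivatives with respect to arc length on $S^1$), a positive function. The centro-affine curvature of $K$ is $H_K=(h_K^{3}f_K)^{-1}$, and $$\mathcal{R}_{-2}(K)=\frac{\max_{S^1}(h_K^{3}f_K)}{\min_{S^1}(h_K^{3}f_K)}=\frac{\max_{S^1} H_K}{\min_{S^1} H_K}.$$ For a convex body $K$ with the origin in its interior, $K^*=\{y: x\cdot y\le 1\ \forall x\in K\}$ is the polar body, and for $x\in\operatorname{int}K$ set $K^x=(K-x)^*$. The Santaló point $s(K)$ of $K$ is the unique point $s\in\operatorname{int}K$ such that $V(K^s)\le V(K^x)$ for all $x\in\operatorname{int}K$. The Banach–Mazur distance of convex bodies $K,L$ in $\mathbb{R}^n$ is $$d_{\mathcal{BM}}(K,L)=\min\{\lambda\geq 1: (K-x)\subseteq \ell(L-y)\subseteq \lambda(K-x)\ \text{for some}\ \ell\in GL(n),\ x,y\in\mathbb{R}^n\}.$$ *)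

(* Defs.v *)
From HB Require Import structures.
From mathcomp Require Import all_boot all_order all_algebra.
From mathcomp Require Import all_classical all_reals all_analysis.

Set Implicit Arguments.
Unset Strict Implicit.
Unset Printing Implicit Defensive.

Import Order.TTheory GRing.Theory Num.Theory.
Import numFieldNormedType.Exports.

Local Open Scope ring_scope.
Local Open Scope classical_set_scope.

(* The library norm on [R * R] is the sup norm; it induces the usual topology,
   but the Euclidean structure has to come from [dot]. *)
Notation plane R := (R * R)%type.

Section Plane.
Variable R : realType.
Implicit Types (K L : set (plane R)) (x y u v : plane R) (t : R).

Definition dot x y : R := x.1 * y.1 + x.2 * y.2.

Definition cross x y : R := x.1 * y.2 - x.2 * y.1.

Definition enorm x : R := Num.sqrt (dot x x).

Definition unit_disc : set (plane R) := [set x | enorm x <= 1].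

(* Arc-length parametrization of the unit circle. *)
Definition circle t : plane R := (cos t, sin t).

Definition area (A : set (plane R)) : \bar R :=
  (@lebesgue_measure R \x @lebesgue_measure R)%E A.

Definition translate K x : set (plane R) := [set z - x | z in K].

Definition dilate (c : R) K : set (plane R) := [set c *: z | z in K].

Definition origin_symmetric K : Prop := K = [set - z | z in K].

Definition boundary K : set (plane R) := closure K `\` K°.

Definition convex_body K : Prop :=
  [/\ compact K, convex_set (K : set (convex_lmodType (plane R)))
    & K° !=set0].

Definition smooth_curve (g : R -> plane R) : Prop :=
  forall (n : nat) t, derivable (g^`(n))%classic t 1.

(* Signed curvature of a regular curve, positive when it turns
   counterclockwise. *)
Definition curvature (g : R -> plane R) t : R :=
  cross (g^`()%classic t) (g^`(2)%classic t) / enorm (g^`()%classic t) ^+ 3.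

(* [g] is a [T]-periodic regular parametrization of a simple closed curve. *)
Definition closed_curve_param (g : R -> plane R) (T : R) : Prop :=
  [/\ 0 < T,
      forall t, g (t + T) = g t,
      set_inj `[0, T[ g
    & forall t, g^`()%classic t != 0].

(* Since the curvature is signed, [g] runs counterclockwise; every smooth
   boundary curve of a convex body can be so oriented. *)
Definition smooth_strictly_convex K : Prop :=
  exists (g : R -> plane R) (T : R),
    [/\ smooth_curve g, closed_curve_param g T, range g = boundary K
      & forall t, 0 < curvature g t].

Definition F02 K : Prop :=
  [/\ convex_body K, smooth_strictly_convex K & K° 0].

(* For compact nonempty [K] the supremum is a maximum. *)
Definition support_fun K u : R := sup [set dot x u | x in K].

(* f_K = h_K'' + h_K at the point [circle t]. *)
Definition curvature_fun K t : R :=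
  ((support_fun K \o circle)^`(2))%classic t + support_fun K (circle t).

Definition h3f K t : R := support_fun K (circle t) ^+ 3 * curvature_fun K t.

(* For [K] in F_0^2, [h3f K] is continuous and periodic, so that the supremum
   and the infimum over the circle are attained. *)
Definition Rm2 K : R := sup (range (h3f K)) / inf (range (h3f K)).

Definition polar K : set (plane R) :=
  [set y | forall x, K x -> dot x y <= 1].

Definition polar_at K x : set (plane R) := polar (translate K x).

Definition is_santalo_point K s : Prop :=
  K° s /\
  forall x, K° x -> (area (polar_at K s) <= area (polar_at K x))%E.

(* For convex bodies the infimum is a minimum. *)
Definition banach_mazur K L : R :=
  inf [set lam : R | 1 <= lam /\
    exists (l : {linear plane R -> plane R}) (x y : plane R),
      [/\ bijective l,
          translate K x `<=` l @` translate L y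
        & l @` translate L y `<=` dilate lam (translate K x)]].

End Plane.

(* Main.v *)
Require Import Defs.
From HB Require Import structures.
From mathcomp Require Import all_boot all_order all_algebra.
From mathcomp Require Import all_classical all_reals all_analysis.
From mathcomp Require Import ring lra.

(** The support function [h] of a body in F_0^2 solves the Ermakov-Pinney
    equation [h'' + h = p / h^3] with [p = h^3 f], and R_{-2} is the ratio of
    the extrema of [p].  The constant [p] are those of the ellipses centred at
    the origin, and the equation is covariant under linear maps: for a matrix
    [B] of positive determinant the function [k s = h_K (B (cos s, sin s))]
    solves the same equation with [p] multiplied by [det B ^ 2] and composed
    with a change of angle (pinched_transform).  So one may choose a
    linear normalization and compare [k] with the solution [1] for [p = 1].
    A bound [c1 <= k <= c2] squeezes [K] between two homothetic ellipses
    centred at the origin and bounds the Banach-Mazur distance by [c2 / c1]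
    (banach_mazur_bounds).

    In general, normalize at a maximum of [h], so that [k 0 = 1], [k' 0 = 0]
    and [1 <= p <= 1 + e] with [e = R_{-2} - 1].  The energy
    [y = k'^2 + k^2 + 1 / k^2] is [2] at [0] and satisfies [y' <= e y^2], which
    over a period leaves [(k - 1)^2 <= 64 e] (pinched_near_constant).  Hence
    d_BM - 1 is of order [sqrt e], and its fourth power is a fortiori of order
    [e].  The numbers [R - 1] and [sqrt R - 1] are comparable for bounded [R],
    so the two local bounds are equivalent up to the constant.

    In the symmetric case, normalize by an inscribed ellipse of maximal area:
    [k >= 1], and every arc of length [pi / 2] contains a contact point
    [k = 1] (john_position).  The function [v = k^2 - 1] satisfies
    [v'' + 4 v = 2 k'^2 + 2 (k - 1 / k)^2 + 2 (p - 1) / k^2], so if [p > 1] held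
    everywhere, [v] would increase over a length [pi / 4] on either side of
    each contact point and two contact points would be too far apart; hence
    [min p <= 1] (pinched_contact_le1).  On the other hand the energy
    [k'^2 + k^2 + max p / k^2] decreases while [k] increases, which gives
    [k^2 <= max p] (pinched_upper).  Therefore
    [1 <= k <= sqrt (max p) <= sqrt R_{-2}].

    That [h] is twice differentiable comes from the Gauss map.  The normal
    of the boundary curve has a differentiable angle with positive derivative;
    inverting it parametrizes the boundary by the normal angle, and
    [h'' + h] comes out as the radius of curvature (support_of_curve). *)

Set Implicit Arguments.
Unset Strict Implicit.
Unset Printing Implicit Defensive.

Import Order.TTheory GRing.Theory Num.Theory.
Import numFieldNormedType.Exports.

Local Open Scope ring_scope.
Local Open Scope classical_set_scope.

(** * Rules of differentiation *)

Section Derivatives.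
Context {R : realType}.
Implicit Types (f g : R -> R) (t a b c : R).

Lemma deriv_eq f t a b : is_derive t 1 f a -> a = b -> is_derive t 1 f b.
Proof. by move=> H <-. Qed.

Lemma deriv_cst c t : is_derive t 1 (fun=> c) 0.
Proof. exact: is_derive_cst. Qed.

Lemma deriv_id t : is_derive t 1 (fun s : R => s) 1.
Proof. exact: is_derive_id. Qed.

Lemma deriv_add f g t a b : is_derive t 1 f a -> is_derive t 1 g b ->
  is_derive t 1 (fun s => f s + g s) (a + b).
Proof. move=> Hf Hg; exact: is_deriveD. Qed.

Lemma deriv_opp f t a : is_derive t 1 f a -> is_derive t 1 (fun s => - f s) (- a).
Proof. move=> Hf; exact: is_deriveN. Qed.

Lemma deriv_mul f g t a b : is_derive t 1 f a -> is_derive t 1 g b ->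
  is_derive t 1 (fun s => f s * g s) (f t * b + g t * a).
Proof. move=> Hf Hg; exact: is_deriveM. Qed.

Lemma deriv_exp f n t a : is_derive t 1 f a ->
  is_derive t 1 (fun s => f s ^+ n) (n%:R * f t ^+ n.-1 * a).
Proof.
move=> Hf; have := @is_deriveX _ _ f n t 1 a Hf.
by congr (is_derive _ _ _ _); apply/funext => s; rewrite fctE.
Qed.

Lemma deriv_inv f t a : f t != 0 -> is_derive t 1 f a ->
  is_derive t 1 (fun s => (f s)^-1) (- a / f t ^+ 2).
Proof.
move=> f0 Hf; have H := @is_deriveV R f t a 1 f0 Hf. apply: (deriv_eq H).
by rewrite /GRing.scale /= mulrC mulrN mulNr.
Qed.

Lemma deriv_comp f g t a b : is_derive (g t) 1 f a -> is_derive t 1 g b ->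
  is_derive t 1 (fun s => f (g s)) (a * b).
Proof. move=> Hf Hg; exact: (@is_derive1_comp _ f g). Qed.

Lemma deriv_cos f t a : is_derive t 1 f a ->
  is_derive t 1 (fun s => cos (f s)) (- sin (f t) * a).
Proof. by move=> Hf; apply: deriv_comp. Qed.

Lemma deriv_sin f t a : is_derive t 1 f a ->
  is_derive t 1 (fun s => sin (f s)) (cos (f t) * a).
Proof. by move=> Hf; apply: deriv_comp. Qed.

Lemma deriv_sqrt f t a : 0 < f t -> is_derive t 1 f a ->
  is_derive t 1 (fun s => Num.sqrt (f s)) (a / (2 * Num.sqrt (f t))).
Proof.
move=> f0 Hf; apply: deriv_eq; first exact: (deriv_comp (is_derive1_sqrt f0) Hf).
by rewrite mulrC.
Qed.
End Derivatives.

(** The functions are compared syntactically with those of the hypotheses, since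
    conversion would unfold locally defined functions. *)
Ltac deriv_step :=
  cbv beta;
  first [ match goal with
    | H : is_derive _ _ ?f _ |- is_derive _ _ ?g _ => constr_eq f g; eapply H
    | H : forall t : _, is_derive _ _ ?f _ |- is_derive _ _ ?g _ =>
        constr_eq f g; eapply H
    | |- is_derive _ _ _ _ => fail 1
    | |- _ => eassumption
    end
  | lazymatch goal with
    | |- is_derive _ _ (fun s => @?A s + @?B s) _ => eapply (@deriv_add _ A B)
    | |- is_derive _ _ (fun s => - @?A s) _ => eapply (@deriv_opp _ A)
    | |- is_derive _ _ (fun s => @?A s * @?B s) _ => eapply (@deriv_mul _ A B)
    | |- is_derive _ _ (fun s => @?A s ^+ ?n) _ => eapply (@deriv_exp _ A n)
    | |- is_derive _ _ (fun s => (@?A s)^-1) _ => eapply (@deriv_inv _ A)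
    | |- is_derive _ _ (fun s => cos (@?A s)) _ => eapply (@deriv_cos _ A)
    | |- is_derive _ _ (fun s => sin (@?A s)) _ => eapply (@deriv_sin _ A)
    | |- is_derive _ _ (fun s => Num.sqrt (@?A s)) _ => eapply (@deriv_sqrt _ A)
    | |- is_derive _ _ (fun s => s) _ => eapply deriv_id
    | |- is_derive ?t ?v (fun s => ?f s) ?a => progress change (is_derive t v f a)
    | |- is_derive _ _ (fun s => ?f (@?A s)) _ =>
        first [ eapply deriv_cst | eapply (@deriv_comp _ f A) ]
    | |- is_derive _ _ (fun s => _) _ => eapply deriv_cst
    end ].
(** Differentiates an explicit expression by the rules above; what is left is to
    compare the derivative so obtained with the announced one. *)
Ltac deriv := eapply deriv_eq; [ repeat deriv_step | cbv beta ].

(** * Real analysis on the line *)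

Section RealAnalysis.
Context {R : realType}.
Implicit Types (f g : R -> R) (t a b c T : R).

Lemma deriv_continuous f t a : is_derive t 1 f a -> {for t, continuous f}.
Proof.
move=> H; apply: differentiable_continuous; apply/derivable1_diffP.
exact: ex_derive.
Qed.

Lemma continuous_within f (A : set R) : continuous f -> {within A, continuous f}.
Proof. by move=> H; apply: continuous_subspaceT. Qed.

Lemma deriv_ge0_le f (f1 : R -> R) a b : a <= b ->
  (forall t, a <= t <= b -> is_derive t 1 f (f1 t)) ->
  (forall t, a <= t <= b -> 0 <= f1 t) -> f a <= f b.
Proof.
move=> ab Hf f10.
have [||c /[!in_itv]/= cab E] := @MVT_segment R f f1 a b ab.
- by move=> x /[!in_itv]/= /andP[? ?]; apply: Hf; rewrite !ltW.
- apply: derivable_within_continuous => x /[!in_itv]/= xab.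
  by apply: ex_derive; exact: Hf.
by rewrite -subr_ge0 E mulr_ge0 ?f10 // subr_ge0.
Qed.

Lemma deriv_0_const f a b : a <= b ->
  (forall t, a <= t <= b -> is_derive t 1 f 0) -> f a = f b.
Proof.
move=> ab Hf; apply/eqP; rewrite eq_le; apply/andP; split.
  by apply: (@deriv_ge0_le _ (fun=> 0)).
rewrite -lerN2; apply: (@deriv_ge0_le (fun x => - f x) (fun=> 0)) => // t tab.
by deriv; [exact: Hf | exact: oppr0].
Qed.

Lemma deriv_gt0_lt f (f1 : R -> R) a b : a < b ->
  (forall t, a <= t <= b -> is_derive t 1 f (f1 t)) ->
  (forall t, a < t < b -> 0 < f1 t) -> f a < f b.
Proof.
move=> ab Hf f10.
have [||c /[!in_itv]/= cab E] := @MVT R f f1 a b ab.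
- by move=> x /[!in_itv]/= /andP[? ?]; apply: Hf; rewrite !ltW.
- apply: derivable_within_continuous => x /[!in_itv]/= xab.
  by apply: ex_derive; exact: Hf.
by rewrite -subr_gt0 E mulr_gt0 ?f10 // subr_gt0.
Qed.

(** Reduces statements about a periodic function to one period; [s] is [t] minus
    an integer multiple of [T]. *)
Lemma periodic_fundamental f T t : 0 < T -> (forall t, f (t + T) = f t) ->
  exists2 s, 0 <= s <= T & f s = f t.
Proof.
move=> T0 fT.
have fn (n : nat) u : f (u + n%:R * T) = f u.
  elim: n u => [|n IH] u; first by rewrite mul0r addr0.
  by rewrite -[RHS]IH -[RHS]fT; congr f; rewrite -natr1; ring.
have fz (z : int) u : f (u + z%:~R * T) = f u.
  case: z => n; first exact: fn.
  rewrite -[LHS](fn n.+1); congr f.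
  by rewrite NegzE mulrNz pmulrn; ring.
exists (t + (- Num.floor (t / T))%:~R * T); last exact: fz.
have := floor_itv (t / T); rewrite mulrNz intrD1 => /andP[l1 l2].
rewrite mulNr subr_ge0 -ler_pdivlMr // l1 /=.
rewrite lerBlDr -{1}(mul1r T) -mulrDl -ler_pdivrMr //.
by rewrite addrC ltW.
Qed.

Lemma periodic_extrema f T : 0 < T -> (forall t, f (t + T) = f t) ->
  continuous f -> exists a b, forall t, f a <= f t <= f b.
Proof.
move=> T0 fT fc.
have [a _ Ha] := @EVT_min R f 0 T (ltW T0) (continuous_within fc).
have [b _ Hb] := @EVT_max R f 0 T (ltW T0) (continuous_within fc).
exists a, b => t; have [s sT <-] := periodic_fundamental t T0 fT.
by rewrite Ha ?Hb // in_itv.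
Qed.

(** The zero [c] is the supremum of the points of [a, b] where [f <= 0]; it
    locates the start of the last stretch on which a quantity is positive. *)
Lemma last_nonpositive f a b : continuous f -> a <= b -> f a <= 0 -> 0 < f b ->
  exists c, [/\ a <= c, c < b, f c = 0 & forall t, c < t -> t <= b -> 0 < f t].
Proof.
move=> fc ab fa fb.
pose S := [set t | a <= t <= b /\ f t <= 0].
have Sub : ubound S b by move=> t [/andP[]].
have S0 : S a by split=> //; rewrite lexx.
have hS : has_sup S by split; [exists a | exists b].
pose c := sup S.
have ac : a <= c by apply: ub_le_sup => //; exists b.
have cb : c <= b by apply: ge_sup => //; exists a.
have pos t : c < t -> t <= b -> 0 < f t.
  move=> ct tb; rewrite ltNge; apply/negP => ft.
  have : t <= c by apply: ub_le_sup; [exists b | split=> //; rewrite tb (le_trans ac (ltW ct))].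
  by rewrite leNgt ct.
have fc0 : f c <= 0.
  rewrite leNgt; apply/negP => fcp.
  have /nbhs_ballP[e e0 He] : \forall x \near c, 0 < f x.
    exact: (cvgr_gt _ (fc c)).
  have [t [/andP[at_ tb] ft] tc] := sup_adherent e0 hS.
  have tc' : t <= c by apply: ub_le_sup; [exists b | split=> //; rewrite at_].
  have : 0 < f t.
    apply: He; rewrite /ball /= ger0_norm ?subr_ge0 //.
    by rewrite ltrBlDr -ltrBlDl.
  by rewrite ltNge ft.
have cb' : c < b by rewrite lt_neqAle cb andbT; apply: contraTneq fc0 => ->; rewrite -ltNge.
exists c; split=> //; apply/eqP; rewrite eq_le fc0 /=.
rewrite leNgt; apply/negP => fcn.
have /nbhs_ballP[e /= e0 He] : \forall x \near c, f x < 0.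
  exact: (cvgr_lt _ (fc c)).
pose t := Num.min (c + e / 2) b.
have ct : c < t by rewrite lt_min cb' andbT; lra.
have tb : t <= b by rewrite ge_min lexx orbT.
have := pos _ ct tb; rewrite ltNge ltW //; apply: He.
rewrite /ball /= ler0_norm ?subr_le0 ?ltW //.
have : t <= c + e / 2 by rewrite ge_min lexx.
by lra.
Qed.

Lemma deriv_at_max f (f1 : R -> R) t : (forall s : R, f s <= f t) ->
  (forall s : R, is_derive s 1 f (f1 s)) -> f1 t = 0.
Proof.
move=> fmax Hf.
have [_ H] : is_derive t 1 f 0.
  apply: (@derive1_at_max R f (t - 1) (t + 1)).
  - lra.
  - by move=> x _; apply: ex_derive.
  - by rewrite in_itv /=; lra.
  - by move=> x _; exact: fmax.
by have [_ <-] := Hf t.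
Qed.

(** Were [a] positive, [f1] would be positive just to the right of [t], where
    it vanishes, so [f] would exceed [f t] there. *)
Lemma deriv2_at_max f (f1 : R -> R) t a : (forall s : R, f s <= f t) ->
  (forall s : R, is_derive s 1 f (f1 s)) -> is_derive t 1 f1 a -> a <= 0.
Proof.
move=> fmax Hf Hf1.
rewrite leNgt; apply/negP => a0.
have f1t : f1 t = 0 by exact: deriv_at_max.
have /is_derive1_caratheodory[q [qE qc qt]] := Hf1.
have /nbhs_ballP[e /= e0 He] : \forall x \near t, 0 < q x.
  by apply: (cvgr_gt _ qc); rewrite qt.
have : f t < f (t + e / 2).
  apply: (@deriv_gt0_lt f f1) => [|s sI]; first lra.
  have := qE s; rewrite f1t subr0 => ->; apply: mulr_gt0; last lra.
  by apply: He; rewrite /ball /= ler0_norm; lra.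
by rewrite ltNge fmax.
Qed.

(** The integral from [- n.+1] is differentiable only to the right of its
    starting point, hence the family indexed by [n], pinned to agree at [0]. *)
Lemma primitive_from f (n : nat) : continuous f ->
  exists F, F 0 = 0 /\ forall t : R, - n.+1%:R < t -> is_derive t 1 F (f t).
Proof.
move=> fc; pose m := - n.+1%:R : R.
pose G x := (\int[lebesgue_measure]_(t in [set` `[m, x]]) (f t))%R.
have HG t : m < t -> is_derive t 1 G (f t).
  move=> mt.
  have int : lebesgue_measure.-integrable `[m, t + 1] (EFin \o f).
    apply: continuous_compact_integrable; first exact: segment_compact.
    exact: continuous_within.
  have [dG GE] := @continuous_FTC1_closed R f m t (t + 1) (ltr_pwDr ltr01 (lexx t)) int mt (fc t).
  by apply: DeriveDef; [exact: dG|rewrite -derive1E; exact: GE].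
exists (fun x => G x - G 0); split; first by rewrite subrr.
move=> t mt; deriv; first exact: HG.
by rewrite oppr0 addr0.
Qed.

(** Two members of the family of local primitives agree where both are
    primitives, so at each point any of them with a large enough index will do. *)
Lemma primitive f : continuous f -> exists F : R -> R, forall t : R, is_derive t 1 F (f t).
Proof.
move=> fc.
have [F HF] := @choice nat (R -> R) _ (fun n => primitive_from n fc).
have agree n m t : - n.+1%:R < t -> - m.+1%:R < t -> F n t = F m t.
  move=> nt mt; apply/eqP; rewrite -subr_eq0; apply/eqP.
  have [[Fn0 Fn] [Fm0 Fm]] := (HF n, HF m).
  pose D x := F n x - F m x.
  have D0 : D 0 = 0 by rewrite /D Fn0 Fm0 subrr.
  have nn k : - k.+1%:R < 0 :> R by rewrite oppr_lt0.
  have HD x : Order.min 0 t <= x -> is_derive x 1 D 0.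
    move=> xt; rewrite /D; deriv; [apply: Fn|apply: Fm|by rewrite subrr];
      by apply: lt_le_trans xt; rewrite lt_min ?nn ?nt ?mt.
  rewrite -/(D t) -D0; have [t0|t0] := leP 0 t.
    apply/esym/deriv_0_const => // x /andP[x0 _]; apply: HD.
    by rewrite ge_min x0.
  apply: deriv_0_const; first exact: ltW.
  by move=> x /andP[xt _]; apply: HD; rewrite ge_min xt orbT.
pose N (x : R) := Num.truncn `|x|.
have ltN x : - (N x).+1%:R < x.
  by rewrite ltrNl (le_lt_trans (ler_norm _)) // normrN truncnS_gt.
exists (fun x => F (N x) x) => t.
have tN : - (N t).+1%:R < t by exact: ltN.
apply: (@near_eq_is_derive _ _ _ (F (N t))); last exact: (HF (N t)).2.
near=> x; apply: agree => //.
by near: x; exact: lt_nbhsr.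
Unshelve. all: by end_near. Qed.
End RealAnalysis.

(** * Angles of plane curves *)

Section Angles.
Context {R : realType}.

Lemma polar_unit (x y : R) : x ^+ 2 + y ^+ 2 = 1 ->
  exists th, x = cos th /\ y = sin th.
Proof.
move=> xy1.
have x1 : -1 <= x <= 1.
  rewrite -ler_norml -(@ler_pXn2r _ 2) ?nnegrE ?normr_ge0 //.
  by rewrite real_normK ?num_real // expr1n -xy1 lerDl sqr_ge0.
have cx : cos (acos x) = x by rewrite acosK ?in_itv.
have sx : sin (acos x) = `|y|.
  rewrite sin_acos // -sqrtr_sqr; congr Num.sqrt; rewrite -xy1; ring.
have [y0|y0] := leP 0 y.
  by exists (acos x); rewrite cx sx ger0_norm.
by exists (- acos x); rewrite cosN sinN cx sx ltr0_norm // opprK.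
Qed.

Lemma polar_coord (x y : R) :
  exists th, x = Num.sqrt (x ^+ 2 + y ^+ 2) * cos th /\
             y = Num.sqrt (x ^+ 2 + y ^+ 2) * sin th.
Proof.
set N := x ^+ 2 + y ^+ 2.
have [N0|N0] := leP N 0.
  have x2 := sqr_ge0 x; have y2 := sqr_ge0 y.
  have /eqP : x ^+ 2 = 0 by rewrite /N in N0; lra.
  have /eqP : y ^+ 2 = 0 by rewrite /N in N0; lra.
  rewrite !sqrf_eq0 => /eqP -> /eqP ->; exists 0.
  by rewrite sin0 mulr0 (ler0_sqrtr N0) mul0r.
have r0 : Num.sqrt N != 0 by rewrite gt_eqF // sqrtr_gt0.
have rN := sqr_sqrtr (ltW N0).
have [|th [cE sE]] := @polar_unit (x / Num.sqrt N) (y / Num.sqrt N).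
  by rewrite !expr_div_n rN -mulrDl divff // gt_eqF.
by exists th; rewrite -cE -sE !mulrA -![_ * _ / _]mulrA ![Num.sqrt N * _]mulrC !divfK.
Qed.

(** The angle is a primitive of the angular velocity, started at a polar angle
    of the initial point.  For this choice the component of the unit vector
    in the direction of [(x, y)] along [(cos th, sin th)] has zero derivative,
    hence stays [1]. *)
Lemma angle_lift (x x1 y y1 : R -> R) :
  (forall s : R, is_derive s 1 x (x1 s)) -> (forall s : R, is_derive s 1 y (y1 s)) ->
  continuous x1 -> continuous y1 -> (forall s, 0 < x s ^+ 2 + y s ^+ 2) ->
  exists th : R -> R, forall s : R,
    [/\ is_derive s 1 th ((x s * y1 s - y s * x1 s) / (x s ^+ 2 + y s ^+ 2)),
        x s = Num.sqrt (x s ^+ 2 + y s ^+ 2) * cos (th s)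
      & y s = Num.sqrt (x s ^+ 2 + y s ^+ 2) * sin (th s)].
Proof.
move=> Hx Hy x1c y1c N0.
have xc : continuous x by move=> s; apply: deriv_continuous.
have yc : continuous y by move=> s; apply: deriv_continuous.
pose w s := (x s * y1 s - y s * x1 s) / (x s ^+ 2 + y s ^+ 2).
have wc : continuous w.
  move=> s; apply: cvgM.
    by apply: cvgB; apply: cvgM; [exact: xc|exact: y1c|exact: yc|exact: x1c].
  apply: cvgV; first by rewrite gt_eqF.
  by apply: cvgD; apply: cvgM; (exact: xc || exact: yc).
have [P HP] := primitive wc.
have [th0 [x0E y0E]] := polar_coord (x 0) (y 0).
pose th (s : R) := th0 + (P s - P 0).
have Hth (s : R) : is_derive s 1 th (w s).
  by rewrite /th; deriv; ring.
exists th => s; set N := x s ^+ 2 + y s ^+ 2.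
pose F (s : R) := (x s * cos (th s) + y s * sin (th s)) / Num.sqrt (x s ^+ 2 + y s ^+ 2).
have HF (u : R) : is_derive u 1 F 0.
  have Nu := N0 u.
  have r0 : Num.sqrt (x u ^+ 2 + y u ^+ 2) != 0 by rewrite gt_eqF // sqrtr_gt0.
  rewrite /F; deriv.
  have rN := sqr_sqrtr (ltW Nu).
  have wE : w u * (x u ^+ 2 + y u ^+ 2) = x u * y1 u - y u * x1 u.
    by rewrite /w divfK // gt_eqF.
  move: r0 rN; set r := Num.sqrt _ => r0 rN.
  have r3 : r ^+ 3 != 0 by rewrite expf_neq0.
  apply: (mulfI r3); rewrite mulr0 /= !expr1.
  transitivity (r ^+ 2 * (x u * (- sin (th u) * w u) + cos (th u) * x1 u +
     (y u * (cos (th u) * w u) + sin (th u) * y1 u))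
     - (x u * cos (th u) + y u * sin (th u)) * (x u * x1 u + y u * y1 u)).
    by field.
  rewrite rN; transitivity ((w u * (x u ^+ 2 + y u ^+ 2) - (x u * y1 u - y u * x1 u)) *
    (y u * cos (th u) - x u * sin (th u))); first by ring.
  by rewrite wE subrr mul0r.
have rs u : 0 < Num.sqrt (x u ^+ 2 + y u ^+ 2) by rewrite sqrtr_gt0.
have F0 : F 0 = 1.
  have t0 : th 0 = th0 by rewrite /th subrr addr0.
  have := rs 0; have := sqr_sqrtr (ltW (N0 0)).
  rewrite /F t0; move: x0E y0E; set r := Num.sqrt _ => xE yE rE r0.
  rewrite xE yE -!mulrA ![_ / r]mulrC.
  transitivity ((cos th0 ^+ 2 + sin th0 ^+ 2) * (r / r)); first by ring.
  by rewrite cos2Dsin2 mul1r divff // gt_eqF.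
have Fs : F s = 1 by rewrite -F0; apply: is_derive_0_is_cst.
have := rs s; have := sqr_sqrtr (ltW (N0 s)); move: Fs.
rewrite /F -/N; set r := Num.sqrt N => Fs rE r0.
have E1 : x s * cos (th s) + y s * sin (th s) = r.
  by have := congr1 (fun z => z * r) Fs; rewrite mul1r divfK ?gt_eqF.
have cs := cos2Dsin2 (th s).
have E2 : x s * sin (th s) - y s * cos (th s) = 0.
  apply/eqP; rewrite -sqrf_eq0; apply/eqP.
  transitivity (N * (cos (th s) ^+ 2 + sin (th s) ^+ 2)
    - (x s * cos (th s) + y s * sin (th s)) ^+ 2); first by rewrite /N; ring.
  by rewrite E1 cs rE mulr1 subrr.
split; first exact: Hth.
- rewrite -E1 -[LHS]mulr1 -cs.
  transitivity ((x s * cos (th s) + y s * sin (th s)) * cos (th s)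
    + (x s * sin (th s) - y s * cos (th s)) * sin (th s)); first by ring.
  by rewrite E2 mul0r addr0.
- rewrite -E1 -[LHS]mulr1 -cs.
  transitivity ((x s * cos (th s) + y s * sin (th s)) * sin (th s)
    - (x s * sin (th s) - y s * cos (th s)) * cos (th s)); first by ring.
  by rewrite E2 mul0r subr0.
Qed.
End Angles.

(** * The Ermakov-Pinney equation *)

Section Pinney.
Context {R : realType}.

(** The data of a positive solution of [h'' + h = p / h^3] with [a <= p <= b];
    [h1] and [h2] are the first two derivatives of [h]. *)
Definition pinched (a b : R) (h h1 h2 : R -> R) := forall t : R,
  [/\ is_derive t 1 h (h1 t), is_derive t 1 h1 (h2 t), 0 < h t
    & a <= h t ^+ 3 * (h2 t + h t) <= b].

(** With [g = 1 / h] and [y = h'^2 + h^2 + g^2] one has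
    [y' = 2 h' g^3 (p - 1) <= e y^2], so [1 / y + e t] is nondecreasing, and
    [y - 2] dominates [(h - g)^2 >= (h - 1)^2].  The length [8] exceeds a full
    period, and [32 e <= 1] keeps [y] below [4] on it. *)
Lemma pinched_near_constant (e s0 : R) (h h1 h2 : R -> R) : pinched 1 (1 + e) h h1 h2 ->
  32 * e <= 1 -> h s0 = 1 -> h1 s0 = 0 ->
  forall s, s0 <= s <= s0 + 8 -> (h s - 1) ^+ 2 <= 64 * e.
Proof.
move=> Hp e32 hs0 h1s0 s sI.
have H0 (t : R) : is_derive t 1 h (h1 t) by have [] := Hp t.
have H1 (t : R) : is_derive t 1 h1 (h2 t) by have [] := Hp t.
have hp t : 0 < h t by have [] := Hp t.
have hn t : h t != 0 by rewrite gt_eqF.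
have e0 : 0 <= e by have [_ _ _ /andP[]] := Hp 0; lra.
pose y (t : R) := h1 t ^+ 2 + h t ^+ 2 + ((h t)^-1) ^+ 2.
pose y1 (t : R) := 2 * h1 t * (h t)^-1 ^+ 3 * (h t ^+ 3 * (h2 t + h t) - 1).
have Hy (t : R) : is_derive t 1 y (y1 t).
  rewrite /y /y1; have ht := hn t; deriv.
  by field.
have yp t : 0 < y t.
  rewrite /y ltr_wpDr ?sqr_ge0 // ltr_wpDl ?sqr_ge0 //.
  by rewrite exprn_gt0.
have y1b t : y1 t <= e * y t ^+ 2.
  have [_ _ _ /andP[p1 p2]] := Hp t.
  rewrite /y1 /y; set p := h t ^+ 3 * _ in p1 p2 *.
  have : 0 < (h t)^-1 by rewrite invr_gt0.
  move: (h t) (h1 t) (h t)^-1 => a b g g0.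
  have g2 := sqr_ge0 g.
  have b1 : 2 * b * g <= b ^+ 2 + g ^+ 2 by have := sqr_ge0 (b - g); lra.
  have A : 2 * b * g ^+ 3 * (p - 1) <= (b ^+ 2 + g ^+ 2) * g ^+ 2 * (p - 1).
    rewrite ler_wpM2r ?subr_ge0 //.
    have -> : 2 * b * g ^+ 3 = 2 * b * g * g ^+ 2 by ring.
    exact: ler_wpM2r.
  apply: (le_trans A).
  have B : (b ^+ 2 + g ^+ 2) * g ^+ 2 * (p - 1) <= (b ^+ 2 + g ^+ 2) * g ^+ 2 * e.
    apply: ler_wpM2l; last lra.
    by rewrite mulr_ge0 // addr_ge0 ?sqr_ge0.
  apply: (le_trans B); rewrite mulrC ler_wpM2l // expr2.
  have a2 := sqr_ge0 a; have b2 := sqr_ge0 b.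
  by apply: ler_pM; lra || (rewrite ?addr_ge0).
pose F (t : R) := (y t)^-1 + e * t.
have Fs : F s0 <= F s.
  have /andP[s0s _] := sI.
  apply: (@deriv_ge0_le _ F (fun t => - y1 t / y t ^+ 2 + e)) => // t _.
    have yt : y t != 0 by rewrite gt_eqF.
    by rewrite /F; deriv; rewrite mulr1 mulr0 addr0.
  by rewrite mulNr addrC subr_ge0 ler_pdivrMr ?exprn_gt0.
have ys0 : y s0 = 2.
  by rewrite /y hs0 h1s0 invr1 !expr1n expr0n /= add0r.
have yi : 2^-1 - 8 * e <= (y s)^-1.
  have /andP[s0s s8] := sI.
  have : e * (s - s0) <= e * 8 by apply: ler_wpM2l => //; lra.
  by move: Fs; rewrite /F ys0; lra.
have y2 : y s - 2 <= 64 * e.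
  have ys := yp s; have yn : y s != 0 by rewrite gt_eqF.
  have y4 : y s <= 4.
    have : 4^-1 <= (y s)^-1 by lra.
    by rewrite lef_pV2 ?posrE.
  have -> : y s - 2 = 2 * y s * (2^-1 - (y s)^-1) by field.
  have -> : 64 * e = 2 * 4 * (8 * e) by ring.
  apply: (@le_trans _ _ (2 * y s * (8 * e))).
    by apply: ler_wpM2l; lra.
  by apply: ler_wpM2r; lra.
apply: le_trans y2; rewrite /y.
have g0 : 0 < (h s)^-1 by rewrite invr_gt0.
have hg : h s * (h s)^-1 = 1 by rewrite divff.
move: (h s) (h1 s) (h s)^-1 g0 hg => a b g g0 ag.
have -> : a ^+ 2 = (a - g) ^+ 2 - g ^+ 2 + 2 * (a * g) by ring.
have -> : a - g = (a - 1) * (1 + g).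
  by rewrite mulrDr mulr1 mulrBl mul1r ag; ring.
rewrite ag exprMn.
have b2 := sqr_ge0 b; have a2 := sqr_ge0 (a - 1).
have : (a - 1) ^+ 2 * 1 <= (a - 1) ^+ 2 * (1 + g) ^+ 2.
  apply: ler_wpM2l => //; rewrite -[X in X <= _](expr1n _ 2).
  by rewrite ler_pXn2r ?nnegrE //; lra.
by lra.
Qed.

(** At a minimum [k = 1] the second derivative is nonnegative, so [1 <= M].
    If [k^2] exceeded [M] somewhere, it would do so at a point with [k' > 0];
    from the last critical point [a] before it, [k' > 0] and the energy
    [k'^2 + k^2 + M / k^2] does not increase.  At [a] one has
    [k^4 <= M], since otherwise [k'' < 0] from [a] on and [k'] would decrease;
    so there the energy is at most [1 + M], as [1 <= k^2 <= M], whereas it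
    exceeds [1 + M] once [k^2 > M]. *)
Lemma pinched_upper (m M s0 T : R) (k k1 k2 : R -> R) :
  pinched m M k k1 k2 -> 0 < T -> (forall s, k (s + T) = k s) ->
  (forall s, 1 <= k s) -> k s0 = 1 ->
  1 <= M /\ forall s, k s ^+ 2 <= M.
Proof.
move=> Hp T0 kT k_ge1 ks0.
have H0 (t : R) : is_derive t 1 k (k1 t) by have [] := Hp t.
have H1 (t : R) : is_derive t 1 k1 (k2 t) by have [] := Hp t.
have kp t : 0 < k t by have [] := Hp t.
have kn t : k t != 0 by rewrite gt_eqF.
have kc : continuous k by move=> s; apply: deriv_continuous.
have k1c : continuous k1 by move=> s; apply: deriv_continuous.
have pM t : k t ^+ 3 * (k2 t + k t) <= M by have [_ _ _ /andP[]] := Hp t.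
have mink (s : R) : - k s <= - k s0 by rewrite ks0 lerN2.
have HN0 (t : R) : is_derive t 1 (fun s => - k s) (- k1 t) by deriv.
have HN1 (t : R) : is_derive t 1 (fun s => - k1 s) (- k2 t) by deriv.
have k1s0 : k1 s0 = 0.
  by apply/eqP; rewrite -oppr_eq0; apply/eqP; exact: (deriv_at_max mink HN0).
have M1 : 1 <= M.
  have := deriv2_at_max mink HN0 (HN1 s0); have := pM s0.
  by rewrite ks0 expr1n mul1r; lra.
split=> //.
suff main b : s0 <= b -> k b ^+ 2 <= M.
  move=> s; have kT' u : k (u + T + s0) = k (u + s0) by rewrite addrAC kT.
  have [u /andP[u0 _] E] := @periodic_fundamental R (fun u => k (u + s0)) T (s - s0) T0 kT'.
  by move: E; rewrite subrK => <-; apply: main; lra.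
move=> s0b; rewrite leNgt; apply/negP => kb.
have sqc : continuous (fun s => k s ^+ 2 - M).
  move=> s; apply: (@deriv_continuous _ _ _ (2 * k s * k1 s)).
  by deriv; rewrite /=; ring.
have [||c [s0c cb kc0 kpos]] := last_nonpositive sqc s0b.
- by rewrite ks0 expr1n subr_le0.
- by rewrite subr_gt0.
have kcb : k c < k b.
  rewrite -(@ltr_pXn2r _ 2) ?nnegrE ?ltW //.
  by move/eqP: kc0; rewrite subr_eq0 => /eqP ->.
have [x /andP[cx xb] k1x] : exists2 x, c < x < b & 0 < k1 x.
  have [|x /[!in_itv]/= xI E] := @MVT R k k1 c b cb (fun x _ => H0 x).
    exact: continuous_within.
  exists x => //; rewrite -(@pmulr_lgt0 _ (b - c)) ?subr_gt0 //.
  by rewrite -E subr_gt0.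
have kx : M < k x ^+ 2 by rewrite -subr_gt0 kpos // ltW.
have s0x : s0 <= x by lra.
have [||a [s0a ax k1a k1pos]] := last_nonpositive k1c s0x.
- by rewrite k1s0.
- by [].
have kmono t : a <= t -> t <= x -> k a <= k t.
  move=> at_ tx; apply: (@deriv_ge0_le _ k k1) => // u /andP[au ut].
  move: au; rewrite le_eqVlt => /orP[/eqP <-|au]; first by rewrite k1a.
  by rewrite ltW // k1pos //; lra.
have ka4 : k a ^+ 4 <= M.
  rewrite leNgt; apply/negP => Mka.
  have : - k1 a < - k1 x.
    apply: (@deriv_gt0_lt _ (fun s => - k1 s) (fun s => - k2 s)) => // t /andP[at_ tx].
    have kat := kmono t (ltW at_) (ltW tx).
    have k4 : k a ^+ 4 <= k t ^+ 4 by rewrite ler_pXn2r ?nnegrE // ltW.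
    have : 0 < k t ^+ 3 * (- k2 t) by have := pM t; rewrite mulrDr -exprSr mulrN; lra.
    by rewrite pmulr_rgt0 ?exprn_gt0.
  by rewrite k1a; lra.
pose E (t : R) := k1 t ^+ 2 + k t ^+ 2 + M * (k t)^-1 ^+ 2.
have EE : - E a <= - E x.
  apply: (@deriv_ge0_le _ (fun t => - E t)
    (fun t => 2 * k1 t * (k t)^-1 ^+ 3 * (M - k t ^+ 3 * (k2 t + k t)))) => [|t _|t /andP[at_ tx]].
  - exact: ltW.
  - by rewrite /E; have kt := kn t; deriv; field.
  - have k1t : 0 <= k1 t.
      move: at_; rewrite le_eqVlt => /orP[/eqP <-|at_]; first by rewrite k1a.
      by rewrite ltW // k1pos.
    have kV : 0 <= (k t)^-1 ^+ 3 by rewrite exprn_ge0 // invr_ge0 ltW.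
    by rewrite mulr_ge0 ?subr_ge0 // mulr_ge0 // mulr_ge0.
move: EE; rewrite lerN2 /E k1a expr0n add0r !exprVn.
have Y1 : 1 <= k a ^+ 2 by rewrite -[X in X <= _](expr1n _ 2) ler_pXn2r ?nnegrE // ltW.
have YM : k a ^+ 2 * k a ^+ 2 <= M by rewrite -exprD.
move: (k a ^+ 2) (k x ^+ 2) (k1 x ^+ 2) (sqr_ge0 (k1 x)) Y1 YM kx => Y X Z Z0 Y1 YM XM.
rewrite leNgt => /negP; apply.
have Y0 : 0 < Y by lra.
have X0 : 0 < X by lra.
have YleM : Y <= M by apply: le_trans YM; rewrite ler_peMr // ltW.
have A : Y + M / Y <= 1 + M.
  rewrite -(@ler_pM2r _ Y) // mulrDl divfK ?gt_eqF //.
  have : 0 <= (Y - 1) * (M - Y) by rewrite mulr_ge0 // subr_ge0.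
  by lra.
have B : 1 + M < X + M / X.
  rewrite -(@ltr_pM2r _ X) // [X in _ < X]mulrDl divfK ?gt_eqF //.
  have : 0 < (X - 1) * (X - M) by rewrite mulr_gt0 // subr_gt0; lra.
  by lra.
by lra.
Qed.

(** Put [v = k^2 - 1].  The function
    [v' cos (2 (s0 + d - t)) - 2 v sin (2 (s0 + d - t))] has derivative
    [(v'' + 4 v) cos (2 (s0 + d - t))], which is positive for [p > 1] up to the
    time [pi / 4]; it vanishes at [s0] and equals [v' (s0 + d)] at the end. *)
Lemma pinched_increasing_after_contact (m M s0 d : R) (k k1 k2 : R -> R) :
  pinched m M k k1 k2 -> 1 < m -> k s0 = 1 -> k1 s0 = 0 ->
  0 < d -> d <= pi / 4 -> 0 < k1 (s0 + d).
Proof.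
move=> Hp m1 ks0 k1s0 d0 dpi.
have H0 (t : R) : is_derive t 1 k (k1 t) by have [] := Hp t.
have H1 (t : R) : is_derive t 1 k1 (k2 t) by have [] := Hp t.
have kp t : 0 < k t by have [] := Hp t.
pose F (t : R) := 2 * k t * k1 t * cos (2 * (s0 + d - t))
  - 2 * (k t ^+ 2 - 1) * sin (2 * (s0 + d - t)).
have : F s0 < F (s0 + d).
  apply: (@deriv_gt0_lt _ F (fun t => (2 * k1 t ^+ 2 + 2 * k t * k2 t + 4 * (k t ^+ 2 - 1))
    * cos (2 * (s0 + d - t)))) => [|t _|t /andP[st ts]].
  - by rewrite ltrDl.
  - by rewrite /F; deriv; rewrite /=; ring.
  - apply: mulr_gt0; last by apply: cos_gt0_pihalf; lra.
    have kt := kp t; have [_ _ _ /andP[mp _]] := Hp t.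
    rewrite -(@pmulr_rgt0 _ (k t ^+ 2)) ?exprn_gt0 //.
    have E : k t ^+ 2 * (2 * k1 t ^+ 2 + 2 * k t * k2 t + 4 * (k t ^+ 2 - 1))
      = 2 * (k t ^+ 2 * k1 t ^+ 2) + 2 * (k t ^+ 3 * (k2 t + k t)) - 2
        + 2 * (k t ^+ 2 - 1) ^+ 2 by ring.
    have := sqr_ge0 (k t ^+ 2 - 1); have := sqr_ge0 (k t * k1 t).
    by rewrite E exprMn; lra.
rewrite /F ks0 k1s0 subrr !mulr0 cos0 sin0 expr1n subrr !mulr0 !mul0r subr0 mulr1.
by rewrite subr0 pmulr_rgt0 // mulr_gt0.
Qed.

Lemma pinched_reflect (m M : R) (k k1 k2 : R -> R) : pinched m M k k1 k2 ->
  pinched m M (fun s => k (- s)) (fun s => - k1 (- s)) (fun s => k2 (- s)).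
Proof.
move=> Hp t; have [H0 H1 kp p] := Hp (- t); split=> //.
  by deriv; ring.
by deriv; ring.
Qed.

(** If [p > 1] everywhere then [k'] is positive for a time [pi / 4], and by
    continuity slightly longer, after a contact point [s0], and negative for a
    time [pi / 4] before any contact point.  A contact point in an arc of length
    [pi / 2] that starts just after [s0] contradicts one of the two. *)
Lemma pinched_contact_le1 (m M : R) (k k1 k2 : R -> R) : pinched m M k k1 k2 ->
  (forall s, 1 <= k s) ->
  (forall phi, exists s, phi - pi / 4 <= s <= phi + pi / 4 /\ k s = 1) ->
  m <= 1.
Proof.
move=> Hp k_ge1 contact; rewrite leNgt; apply/negP => m1.
have pi0 := pi_gt0 R.
have H0 (t : R) : is_derive t 1 k (k1 t) by have [] := Hp t.
have H1 (t : R) : is_derive t 1 k1 (k2 t) by have [] := Hp t.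
have k1c : continuous k1 by move=> s; apply: deriv_continuous.
have crit s : k s = 1 -> k1 s = 0.
  move=> ks; have mink (u : R) : - k u <= - k s by rewrite ks lerN2.
  have HN0 (t : R) : is_derive t 1 (fun s => - k s) (- k1 t) by deriv.
  by apply/eqP; rewrite -oppr_eq0; apply/eqP; exact: (deriv_at_max mink HN0).
have incr s d : k s = 1 -> 0 < d -> d <= pi / 4 -> 0 < k1 (s + d).
  by move=> ks; apply: (pinched_increasing_after_contact Hp) => //; exact: crit.
have decr s d : k s = 1 -> 0 < d -> d <= pi / 4 -> k1 (s - d) < 0.
  move=> ks d0 dpi.
  have := @pinched_increasing_after_contact _ _ (- s) d _ _ _ (pinched_reflect Hp) m1.
  rewrite !opprD !opprK => /(_ ks _ d0 dpi); rewrite oppr_gt0; apply.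
  by rewrite crit // oppr0.
have [s0 [_ ks0]] := contact 0.
have /nbhs_ballP[e /= e0 He] : \forall x \near s0 + pi / 4, 0 < k1 x.
  by apply: (cvgr_gt _ (k1c _)); apply: incr => //; lra.
pose n := e / 2.
have [s1 [/andP[l1 l2] ks1]] := contact (s0 + n + pi / 4).
have := decr s1 (pi / 4) ks1.
suff : 0 <= k1 (s1 - pi / 4).
  by rewrite leNgt => /negP A B; apply: A; apply: B; lra.
have [E|] := leP (s1 - pi / 4) s0.
  have s01 : s0 < s1 by rewrite /n in l1; lra.
  exfalso; have := @decr s1 (s1 - s0) ks1.
  have -> : s1 - (s1 - s0) = s0 by ring.
  by rewrite crit // ltxx => A; apply: notF; apply: A; lra.
move=> s0x; apply: ltW; have [E|E] := leP (s1 - pi / 4) (s0 + pi / 4).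
  have := @incr s0 (s1 - pi / 4 - s0) ks0.
  have -> : s0 + (s1 - pi / 4 - s0) = s1 - pi / 4 by ring.
  by apply; lra.
by apply: He; rewrite /ball /= ler0_norm; rewrite /n in l2; lra.
Qed.
End Pinney.

(** * Support functions *)

Section Support.
Context {R : realType}.
Implicit Types (K : set (plane R)) (x y z u v : plane R).

Lemma dotC x y : dot x y = dot y x.
Proof. by rewrite /dot; ring. Qed.

Lemma dotBl x y z : dot (x - y) z = dot x z - dot y z.
Proof. by rewrite /dot /=; ring. Qed.

Lemma dotZl (c : R) x y : dot (c *: x) y = c * dot x y.
Proof. by rewrite /dot /= mulrDr !mulrA. Qed.

Lemma dotZr (c : R) x y : dot x (c *: y) = c * dot x y.
Proof. by rewrite dotC dotZl dotC. Qed.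

Lemma dot_sqr x : dot x x = x.1 ^+ 2 + x.2 ^+ 2.
Proof. by []. Qed.

Lemma dot_ge0 x : 0 <= dot x x.
Proof. by rewrite dot_sqr addr_ge0 // sqr_ge0. Qed.

Lemma dot_gt0 x : x != 0 -> 0 < dot x x.
Proof.
move=> x0; rewrite lt_neqAle dot_ge0 andbT eq_sym; apply: contra x0.
rewrite dot_sqr paddr_eq0 ?sqr_ge0 // !sqrf_eq0 => /andP[/eqP a /eqP b].
by case: x a b => a b /= -> ->.
Qed.

Lemma dot_circle t : dot (circle t) (circle t) = 1 :> R.
Proof. by rewrite dot_sqr /= cos2Dsin2. Qed.

Lemma polar_plane x : exists t, x = enorm x *: circle t.
Proof.
have [t [a b]] := polar_coord x.1 x.2; exists t.
have -> : enorm x *: circle t = (enorm x * cos t, enorm x * sin t) by [].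
by rewrite /enorm dot_sqr -a -b -surjective_pairing.
Qed.

Lemma fst_cont : continuous (@fst R R).
Proof. by move=> z; exact: cvg_fst. Qed.

Lemma snd_cont : continuous (@snd R R).
Proof. by move=> z; exact: cvg_snd. Qed.

Lemma dot_continuous u : continuous (fun x => dot x u).
Proof.
by move=> z; apply: cvgD; (apply: cvgM; [|exact: cvg_cst]); [exact: fst_cont|exact: snd_cont].
Qed.

Lemma support_ub K x u : compact K -> K x -> dot x u <= support_fun K u.
Proof.
move=> cK Kx; apply: ub_le_sup; last by exists x.
have [||c _ Hc] := @compact_EVT_max _ R (fun x => dot x u) K _ cK.
- by exists x.
- by apply: continuous_subspaceT; exact: dot_continuous.
by exists (dot c u) => _ [y Ky <-]; apply: Hc; rewrite inE.
Qed.

Lemma support_le K u b : K !=set0 -> (forall x, K x -> dot x u <= b) ->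
  support_fun K u <= b.
Proof.
move=> [x0 Kx0] H; apply: ge_sup; first by exists (dot x0 u), x0.
by move=> _ [y Ky <-]; exact: H.
Qed.

Lemma supportZ K (r : R) u : compact K -> K !=set0 -> 0 <= r ->
  support_fun K (r *: u) = r * support_fun K u.
Proof.
move=> cK K0 r0; apply/eqP; rewrite eq_le; apply/andP; split.
  apply: support_le => // x Kx; rewrite dotZr ler_wpM2l //; exact: support_ub.
have [->|rn0] := eqVneq r 0.
  have [x Kx] := K0; rewrite mul0r; apply: le_trans (support_ub _ cK Kx).
  by rewrite dotZr mul0r.
have rp : 0 < r by rewrite lt_neqAle eq_sym rn0.
rewrite mulrC -ler_pdivlMr //; apply: support_le => // x Kx.
by rewrite ler_pdivlMr // mulrC -dotZr; exact: support_ub.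
Qed.

Lemma convexE K x y (t : R) : convex_set (K : set (convex_lmodType (plane R))) ->
  K x -> K y -> 0 <= t -> t <= 1 -> K (t *: x + (1 - t) *: y).
Proof.
move=> cK Kx Ky t0 t1.
by have := cK x y (Itv01 t0 t1); rewrite !inE; apply.
Qed.

(** Let [c] be the point of [K] nearest to [z].  If [c] and [z] differ, moving
    from [c] towards a point of [K] cannot reduce the distance to [z], so that
    [z - c] separates [z] from [K]. *)
Lemma support_separation K z : compact K -> convex_set (K : set (convex_lmodType (plane R))) ->
  K !=set0 -> (forall u, dot z u <= support_fun K u) -> K z.
Proof.
move=> cK vK K0 Hz.
pose f x := - dot (x - z) (x - z).
have fc : continuous f.
  move=> x; apply: cvgN; apply: cvgD; apply: cvgM; apply: cvgB;
    (exact: cvg_cst || exact: fst_cont || exact: snd_cont).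
have [c Kc Hc] := compact_EVT_max K0 cK (continuous_subspaceT fc).
rewrite inE in Kc.
have [<-//|cz] := eqVneq c z.
have cz0 : c - z != 0 by rewrite subr_eq0.
have key x : K x -> dot x (z - c) <= dot c (z - c).
  move=> Kx; rewrite leNgt; apply/negP => lt.
  pose a := dot (x - c) (z - c); pose b := dot (x - c) (x - c).
  have a0 : 0 < a by rewrite /a dotBl subr_gt0.
  have b0 : 0 <= b by exact: dot_ge0.
  pose t := a / (a + b).
  have ab0 : 0 < a + b by rewrite ltr_wpDr.
  have t0 : 0 < t by rewrite divr_gt0.
  have t1 : t <= 1 by rewrite ler_pdivrMr // mul1r lerDl.
  have tb : t * b <= a.
    by rewrite /t mulrAC ler_pdivrMr // ler_wpM2l ?lerDr // ltW.
  have := Hc (t *: x + (1 - t) *: c).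
  rewrite inE => /(_ (convexE vK Kx Kc (ltW t0) t1)).
  rewrite /f lerN2.
  have -> : dot (t *: x + (1 - t) *: c - z) (t *: x + (1 - t) *: c - z)
    = dot (c - z) (c - z) - t * (2 * a - t * b).
    by rewrite /a /b /dot /= /GRing.scale /=; ring.
  rewrite lerDl oppr_ge0 leNgt => /negP; apply.
  by rewrite mulr_gt0 //; lra.
have := Hz (z - c); rewrite leNgt => /negP; case.
apply: (@le_lt_trans _ _ (dot c (z - c))); first exact: support_le.
rewrite -subr_gt0 -dotBl dot_gt0 //.
by rewrite -opprB oppr_eq0.
Qed.

End Support.

(** * Ellipses and linear normalization *)

Section Ellipses.
Context {R : realType}.
Implicit Types (K : set (plane R)) (p q x y u v : plane R).

(** The ellipse with conjugate half-diameters [p] and [q], that is, the image of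
    the unit circle under the matrix with columns [p] and [q]. *)
Definition conj_ellipse p q (s : R) : plane R := cos s *: p + sin s *: q.

Lemma conj_ellipse_ray p q u : 0 < cross p q ->
  exists r s, 0 <= r /\ u = r *: conj_ellipse p q s.
Proof.
move=> D0; pose v : plane R := (cross u q / cross p q, cross p u / cross p q).
have [s E] := polar_plane v; exists (enorm v), s; split; first exact: sqrtr_ge0.
have Dn : cross p q != 0 by rewrite gt_eqF.
have [E1 E2] : v.1 = enorm v * cos s /\ v.2 = enorm v * sin s by rewrite {1 3}E.
have -> : enorm v *: conj_ellipse p q s = v.1 *: p + v.2 *: q.
  by rewrite E1 E2 /conj_ellipse scalerDr !scalerA.
rewrite /v [u in LHS]surjective_pairing; congr pair; move: Dn;
  rewrite /= /cross /GRing.scale /= => Dn.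
  by field.
by field.
Qed.

(** If [B] has columns [p] and [q], the two bounds say that [K] contains
    [c1 E] and is contained in [c2 E] for [E] the image of the disc under the
    inverse transpose of [B], whose support function at [B v] is [|v|]. *)
Lemma banach_mazur_bounds K p q (c1 c2 : R) : compact K ->
  convex_set (K : set (convex_lmodType (plane R))) -> K !=set0 ->
  0 < cross p q -> 0 < c1 ->
  (forall s, c1 <= support_fun K (conj_ellipse p q s) <= c2) ->
  1 <= banach_mazur K (@unit_disc R) <= c2 / c1.
Proof.
move=> cK vK K0 D0 c10 Hs.
have c12 : c1 <= c2 by have /andP[] := Hs 0; exact: le_trans.
have c20 : 0 < c2 by lra.
have Dn : cross p q != 0 by rewrite gt_eqF.
have c2n : c2 != 0 by rewrite gt_eqF.
have c1n : c1 != 0 by rewrite gt_eqF.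
pose l (b : plane R) : plane R :=
  ((b.1 * q.2 - b.2 * p.2) * c2 / cross p q, (b.2 * p.1 - b.1 * q.1) * c2 / cross p q).
have llin : linear l.
  by move=> a x y; apply: injective_projections; rewrite /= /GRing.scale /=; ring.
pose L : {linear plane R -> plane R} :=
  HB.pack l (GRing.isLinear.Build R (plane R) (plane R) *:%R l llin).
have Lbij : bijective L.
  exists (fun x : plane R => (dot x p / c2, dot x q / c2)).
    move=> b; rewrite /L /= /l /dot /=; case: b => b1 b2 /=.
    by congr pair; move: Dn; rewrite /cross => Dn; field; rewrite c2n Dn.
  move=> x; rewrite /L /= /l /dot /=; case: x => x1 x2 /=.
  by congr pair; move: Dn; rewrite /cross => Dn; field; rewrite c2n Dn.
have ldot (b u : plane R) (v1 v2 : R) : u = v1 *: p + v2 *: q ->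
    dot (l b) u = c2 * (b.1 * v1 + b.2 * v2).
  by move=> ->; move: Dn; rewrite /l /dot /cross /= /GRing.scale /= => Dn; field.
rewrite /banach_mazur; set A := (X in inf X).
have mem : A (c2 / c1).
  rewrite /A; split; first by rewrite ler_pdivlMr // mul1r.
  exists L, 0, 0; split => //.
  - move=> _ [x Kx <-]; rewrite subr0.
    pose b : plane R := (dot x p / c2, dot x q / c2).
    exists b; last first.
      rewrite /L /= /b /l /dot /=; case: x Kx {b} => x1 x2 /= _.
      by congr pair; move: Dn; rewrite /cross => Dn; field; rewrite c2n Dn.
    exists b; last by rewrite subr0.
    rewrite /unit_disc /=.
    have [s E] := polar_plane b.
    have : c2 * enorm b <= c2.
      have /andP[_ ] := Hs s; apply: le_trans.
      apply: le_trans (support_ub _ cK Kx).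
      have -> : c2 * enorm b = c2 * (b.1 * cos s + b.2 * sin s).
        congr (_ * _); rewrite {2 3}E /=.
        transitivity (enorm b * (cos s ^+ 2 + sin s ^+ 2)); first by rewrite cos2Dsin2 mulr1.
        by rewrite /GRing.scale /=; ring.
      rewrite /b /conj_ellipse /dot /= /GRing.scale /=.
      by rewrite le_eqVlt; apply/orP; left; apply/eqP; field.
    by rewrite -[X in _ <= X -> _]mulr1 ler_pM2l.
  - move=> _ [_ [b bD <-] <-]; rewrite subr0.
    exists ((c1 / c2) *: L b); last first.
      rewrite scalerA; have -> : c2 / c1 * (c1 / c2) = 1 by field; rewrite c2n c1n.
      exact: scale1r.
    exists ((c1 / c2) *: L b); last exact: subr0.
    apply: support_separation => // u.
    have [r [s [r0 ->]]] := conj_ellipse_ray u D0.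
    rewrite supportZ // dotZr ler_wpM2l //.
    have /andP[+ _] := Hs s; apply: le_trans.
    rewrite dotZl /L /= (ldot b _ (cos s) (sin s)) //.
    have -> : c1 / c2 * (c2 * (b.1 * cos s + b.2 * sin s)) =
      c1 * (b.1 * cos s + b.2 * sin s) by field.
    rewrite ger_pMr //.
    have b1 : b.1 ^+ 2 + b.2 ^+ 2 <= 1.
      have : enorm b <= 1 by [].
      rewrite -[X in _ <= X]sqrtr1 ler_sqrt //.
    have := sqr_ge0 (b.1 - cos s); have := sqr_ge0 (b.2 - sin s).
    have := cos2Dsin2 s; rewrite !sqrrB; lra.
have lb : lbound A 1 by move=> lam [].
apply/andP; split; last by apply: ge_inf => //; exists 1.
by apply: lb_le_inf => //; exists (c2 / c1).
Qed.

(** If [B (cos s, sin s)] has polar coordinates [r, th] then [k = r * (h o th)],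
    [th' = D / r^2] with [D = det B], and [r] itself solves the equation with
    the constant [D^2].  Hence the terms in [h'] cancel in [k''] and
    [k'' + k = D^2 (h'' + h) / r^3].  The last two clauses are what is needed to
    read off [k'] at a point where [h'] vanishes. *)
Lemma pinched_transform K p q (a b : R) (h1 h2 : R -> R) : compact K -> K !=set0 ->
  0 < cross p q -> pinched a b (fun t => support_fun K (circle t)) h1 h2 ->
  exists th k1 k2 : R -> R, [/\
    pinched (cross p q ^+ 2 * a) (cross p q ^+ 2 * b)
      (fun s => support_fun K (conj_ellipse p q s)) k1 k2,
    (forall s, conj_ellipse p q s = enorm (conj_ellipse p q s) *: circle (th s))
  & (forall s, enorm (conj_ellipse p q s) * k1 s =
      dot (conj_ellipse p q s) (conj_ellipse p q (s + pi / 2)) * support_fun K (circle (th s))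
       + h1 (th s) * cross p q)].
Proof.
move=> cK K0 D0 Hp.
set h := fun t => support_fun K (circle t).
set D := cross p q.
pose x (s : R) := cos s * p.1 + sin s * q.1.
pose y (s : R) := cos s * p.2 + sin s * q.2.
pose x1 (s : R) := - sin s * p.1 + cos s * q.1.
pose y1 (s : R) := - sin s * p.2 + cos s * q.2.
have Hx (s : R) : is_derive s 1 x (x1 s) by rewrite /x /x1; deriv; ring.
have Hy (s : R) : is_derive s 1 y (y1 s) by rewrite /y /y1; deriv; ring.
have Hx1 (s : R) : is_derive s 1 x1 (- x s) by rewrite /x /x1; deriv; ring.
have Hy1 (s : R) : is_derive s 1 y1 (- y s) by rewrite /y /y1; deriv; ring.
have zE s : conj_ellipse p q s = (x s, y s) by [].
have DE s : x s * y1 s - y s * x1 s = D.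
  rewrite -[RHS]mulr1 -(cos2Dsin2 s) /D /cross /x /y /x1 /y1; ring.
have N0 s : 0 < x s ^+ 2 + y s ^+ 2.
  rewrite lt_neqAle addr_ge0 ?sqr_ge0 // andbT eq_sym paddr_eq0 ?sqr_ge0 // !sqrf_eq0.
  apply/negP => /andP[/eqP xs /eqP ys]; have := DE s; rewrite xs ys !mul0r subrr => E.
  by move: D0; rewrite -/D -E ltxx.
have [||th Hth] := @angle_lift R x x1 y y1 Hx Hy _ _ N0.
- by move=> s; apply: deriv_continuous.
- by move=> s; apply: deriv_continuous.
pose r (s : R) := Num.sqrt (x s ^+ 2 + y s ^+ 2).
have r0 s : 0 < r s by rewrite sqrtr_gt0.
have rn s : r s != 0 by rewrite gt_eqF.
have r2 s : r s ^+ 2 = x s ^+ 2 + y s ^+ 2 by rewrite sqr_sqrtr // ltW.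
have Hr (s : R) : is_derive s 1 r ((x s * x1 s + y s * y1 s) / r s).
  have Ns := N0 s; have rs := rn s; rewrite /r; deriv; rewrite -/(r s) /= !expr1.
  by field.
have Ht (s : R) : is_derive s 1 th (D / r s ^+ 2).
  by have [H _ _] := Hth s; rewrite r2 -(DE s).
have zr s : conj_ellipse p q s = r s *: circle (th s).
  by have [_ xE yE] := Hth s; rewrite zE; apply: injective_projections.
have kE : (fun s => support_fun K (conj_ellipse p q s)) = (fun s => r s * h (th s)).
  by apply/funext => s; rewrite zr supportZ // ltW.
have H0 (t : R) : is_derive t 1 h (h1 t) by have [] := Hp t.
have H1 (t : R) : is_derive t 1 h1 (h2 t) by have [] := Hp t.
pose k1 (s : R) := ((x s * x1 s + y s * y1 s) * h (th s) + D * h1 (th s)) / r s.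
pose k2 (s : R) := D ^+ 2 * (h2 (th s) + h (th s)) / r s ^+ 3 - r s * h (th s).
have Lag s : (x1 s ^+ 2 + y1 s ^+ 2) * r s ^+ 2 = D ^+ 2 + (x s * x1 s + y s * y1 s) ^+ 2.
  by rewrite r2 -(DE s); ring.
exists th, k1, k2; split.
- rewrite kE => s; have rs := rn s; split.
  + by deriv; rewrite /k1; field.
  + rewrite /k1; deriv; rewrite /k2.
    have hn : r s ^+ 5 != 0 by rewrite expf_neq0.
    apply: (mulIf hn).
    transitivity (((x1 s ^+ 2 + y1 s ^+ 2) * r s ^+ 2 - (x s ^+ 2 + y s ^+ 2) * r s ^+ 2
      - (x s * x1 s + y s * y1 s) ^+ 2) * r s ^+ 2 * h (th s)
      + D ^+ 2 * h2 (th s) * r s ^+ 2); first by field.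
    by rewrite Lag -r2; field.
  + by have [_ _ hp _] := Hp (th s); rewrite mulr_gt0.
  + have [_ _ hp /andP[pa pb]] := Hp (th s).
    have -> : (r s * h (th s)) ^+ 3 * (k2 s + r s * h (th s)) =
      D ^+ 2 * (h (th s) ^+ 3 * (h2 (th s) + h (th s))) by rewrite /k2; field.
    by rewrite !ler_pM2l ?exprn_gt0 // pa.
- by move=> s; rewrite {1}zr /enorm zE.
- move=> s; have rs := rn s.
  have -> : enorm (conj_ellipse p q s) = r s by [].
  have -> : conj_ellipse p q (s + pi / 2) = (x1 s, y1 s).
    by rewrite zE /x /y sinDpihalf cosDpihalf.
  by rewrite zE /dot /= -/(h (th s)) -/D /k1; field.
Qed.

End Ellipses.

(** * Inscribed ellipses of maximal area *)

Section John.
Context {R : realType}.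
Implicit Types (K : set (plane R)) (p q x y u v : plane R).

Lemma closed_le_fun (T : topologicalType) (f : T -> R) (b : R) : continuous f ->
  closed [set x | f x <= b].
Proof.
move=> fc; apply: (@closed_comp _ _ f [set y | y <= b]); first by move=> x _; exact: fc.
exact: closed_le.
Qed.

Lemma continuous_comp_fst (U V W : topologicalType) (f : U -> W) : continuous f ->
  continuous (fun C : U * V => f C.1).
Proof. by move=> fc C; apply: (cvg_comp fst f (@cvg_fst _ _ _ _ _)); exact: fc. Qed.

Lemma continuous_comp_snd (U V W : topologicalType) (f : V -> W) : continuous f ->
  continuous (fun C : U * V => f C.2).
Proof. by move=> fc C; apply: (cvg_comp snd f (@cvg_snd _ _ _ _ _)); exact: fc. Qed.

(** The rows [r1], [r2] of a matrix [C] encode the ellipse whose support function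
    at [u] is [|C u|]; those inscribed in [K] form a compact set, which contains
    a disc, so the determinant, proportional to the area, has a positive
    maximum. *)
Lemma maximal_inscribed_ellipse K : compact K -> K !=set0 ->
  continuous (fun t => support_fun K (circle t)) ->
  (forall t, 0 < support_fun K (circle t)) ->
  exists r1 r2 : plane R, [/\ 0 < cross r1 r2,
    (forall u, dot u r1 ^+ 2 + dot u r2 ^+ 2 <= support_fun K u ^+ 2)
  & forall r1' r2' : plane R,
    (forall u, dot u r1' ^+ 2 + dot u r2' ^+ 2 <= support_fun K u ^+ 2) ->
    cross r1' r2' <= cross r1 r2].
Proof.
move=> cK K0 hc h0; set h := fun t => support_fun K (circle t).
have hn t : 0 <= h t by rewrite ltW // /h h0.
have hper t : h (t + pi *+ 2) = h t by rewrite /h /circle cosD2pi sinD2pi.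
have pi2 : 0 < pi *+ 2 :> R by rewrite mulrn_wgt0 // pi_gt0.
have [ta [tb Hab]] := periodic_extrema pi2 hper hc.
pose S := [set C : plane R * plane R | forall t,
  dot (circle t) C.1 ^+ 2 + dot (circle t) C.2 ^+ 2 <= h t ^+ 2].
have SE (C : plane R * plane R) : S C <->
    forall u, dot u C.1 ^+ 2 + dot u C.2 ^+ 2 <= support_fun K u ^+ 2.
  split=> [SC u|H t]; last exact: H.
  have [t ->] := polar_plane u; rewrite supportZ ?sqrtr_ge0 // !dotZl !exprMn -mulrDr.
  by apply: ler_wpM2l; [exact: sqr_ge0|exact: SC].
have Sclosed : closed S.
  have -> : S = \bigcap_(t in [set: R]) [set C : plane R * plane R |
      dot (circle t) C.1 ^+ 2 + dot (circle t) C.2 ^+ 2 <= h t ^+ 2].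
    by apply/seteqP; split => [C SC t _|C SC t]; [exact: SC|exact: SC].
  apply: closed_bigI => t _; apply: closed_le_fun => C.
  have dE : dot (circle t) = (fun x => dot x (circle t)) by apply/funext => x; rewrite dotC.
  have dc : continuous (dot (circle t)) by rewrite dE; exact: dot_continuous.
  have d1 := @continuous_comp_fst _ _ _ _ dc C; have d2 := @continuous_comp_snd _ _ _ _ dc C.
  by apply: cvgD; apply: cvgM.
pose I := `[- h tb, h tb]%classic : set R.
pose B := ((I `*` I) `*` (I `*` I)) : set (plane R * plane R).
have cB : compact B by do 2!apply: compact_setX; exact: segment_compact.
have SB : S `<=` B.
  move=> C SC.
  have hb t : h t ^+ 2 <= h tb ^+ 2.
    by rewrite ler_pXn2r ?nnegrE ?hn //; have /andP[] := Hab t.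
  have bnd (a : R) : a ^+ 2 <= h tb ^+ 2 -> I a.
    rewrite /I /= in_itv /= -ler_norml -[X in X <= _]real_normK ?num_real //.
    by rewrite ler_pXn2r ?nnegrE ?normr_ge0 // ltW // h0.
  have e1 := le_trans (SC 0) (hb 0); have e2 := le_trans (SC (pi / 2)) (hb (pi / 2)).
  move: e1 e2; rewrite /dot /= cos0 sin0 cos_pihalf sin_pihalf !mul1r !mul0r !addr0 !add0r => e1 e2.
  have s1 := sqr_ge0 C.1.1; have s2 := sqr_ge0 C.1.2.
  have s3 := sqr_ge0 C.2.1; have s4 := sqr_ge0 C.2.2.
  by split; split; apply: bnd; lra.
have cS : compact S.
  have -> : S = B `&` S by apply/seteqP; split => [C SC|C []//]; split=> //; exact: SB.
  exact: compact_closedI.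
pose c := h ta.
have c0 : 0 < c by exact: h0.
have Sc : S ((c, 0), (0, c)).
  move=> t; rewrite /dot /= !mulr0 addr0 add0r !exprMn -mulrDl cos2Dsin2 mul1r.
  by rewrite ler_pXn2r ?nnegrE ?hn //; have /andP[] := Hab t.
pose f (C : plane R * plane R) := cross C.1 C.2.
have fc : continuous f.
  move=> C.
  have c11 := @continuous_comp_fst _ _ _ _ (@fst_cont R) C.
  have c12 := @continuous_comp_fst _ _ _ _ (@snd_cont R) C.
  have c21 := @continuous_comp_snd _ _ _ _ (@fst_cont R) C.
  have c22 := @continuous_comp_snd _ _ _ _ (@snd_cont R) C.
  by apply: cvgB; apply: cvgM.
have [||C CS Cmax] := @compact_EVT_max _ R f S _ cS.
- by exists ((c, 0), (0, c)).
- exact: continuous_subspaceT.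
rewrite inE in CS.
have fmax D : S D -> f D <= f C by move=> SD; apply: Cmax; rewrite inE.
exists C.1, C.2; split.
- apply: lt_le_trans (fmax _ Sc); rewrite /f /cross /= mulr0 subr0.
  exact: mulr_gt0.
- by apply/SE.
- by move=> r1 r2 H; apply: (fmax (r1, r2)); apply/SE.
Qed.

(** [p] and [q] are the columns of the inverse of the matrix of a maximal
    inscribed ellipse.  If an arc of length [pi / 2] around [phi] had no contact
    point, then by symmetry neither would the opposite arc.  Stretching the
    ellipse, seen as the unit circle, by [1 + n] in the direction [phi] and
    shrinking it by [1 - n + 2 n^2] in the orthogonal one would keep it inside
    [K] for small [n], while the factor
    [(1 + n) (1 - n + 2 n^2) = 1 + n^2 + 2 n^3] enlarges the area. *)
Lemma john_position K (a b : R) (h1 h2 : R -> R) : compact K -> K !=set0 ->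
  pinched a b (fun t => support_fun K (circle t)) h1 h2 ->
  (forall u, support_fun K (- u) = support_fun K u) ->
  exists p q : plane R, [/\ 0 < cross p q,
    (forall s, 1 <= support_fun K (conj_ellipse p q s))
  & forall phi, exists s, phi - pi / 4 <= s <= phi + pi / 4 /\
      support_fun K (conj_ellipse p q s) = 1].
Proof.
move=> cK K0 Hp Hsym.
have pi0 := pi_gt0 R.
have hc : continuous (fun t => support_fun K (circle t)).
  by move=> t; have [H _ _ _] := Hp t; apply: deriv_continuous H.
have hpos t : 0 < support_fun K (circle t) by have [] := Hp t.
have [r1 [r2 [d0 Hr rmax]]] := maximal_inscribed_ellipse cK K0 hc hpos.
set d := cross r1 r2 in d0 rmax.
have dn : d != 0 by rewrite gt_eqF.
pose p : plane R := (r2.2 / d, - r2.1 / d).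
pose q : plane R := (- r1.2 / d, r1.1 / d).
have D : cross p q = d^-1.
  transitivity ((r1.1 * r2.2 - r1.2 * r2.1) * d^-1 * d^-1); last by rewrite divff // mul1r.
  by rewrite /cross /p /q /=; ring.
have D0 : 0 < cross p q by rewrite D invr_gt0.
set k := fun s => support_fun K (conj_ellipse p q s).
have dz s : dot (conj_ellipse p q s) r1 = cos s /\ dot (conj_ellipse p q s) r2 = sin s.
  have E : r1.1 * r2.2 - r1.2 * r2.1 = d by [].
  rewrite /dot /conj_ellipse /p /q /= /GRing.scale /=; split.
    transitivity (cos s * ((r1.1 * r2.2 - r1.2 * r2.1) / d)); first by ring.
    by rewrite E divff // mulr1.
  transitivity (sin s * ((r1.1 * r2.2 - r1.2 * r2.1) / d)); first by ring.
  by rewrite E divff // mulr1.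
have [th [k1 [k2 [Hk zE _]]]] := pinched_transform cK K0 D0 Hp.
have kc : continuous k.
  by move=> s; have [H _ _ _] := Hk s; apply: deriv_continuous H.
have kpos s : 0 < k s by have [] := Hk s.
have k_ge1 s : 1 <= k s.
  have := Hr (conj_ellipse p q s); have [-> ->] := dz s.
  rewrite cos2Dsin2 -[X in X <= _](expr1n _ 2) ler_pXn2r ?nnegrE //.
  exact: ltW (kpos s).
have kpi s : k (s + pi) = k s.
  rewrite /k -Hsym; congr support_fun.
  by rewrite /conj_ellipse cosDpi sinDpi !scaleNr -opprD opprK.
exists p, q; split=> // phi; apply: contrapT => Hno.
have Hno' s : phi - pi / 4 <= s <= phi + pi / 4 -> 1 < k s.
  move=> sI; rewrite lt_neqAle k_ge1 andbT eq_sym.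
  by apply/eqP => ks; apply: Hno; exists s.
(* [N] is positive: at distance at most [pi / 4] from [phi] modulo [pi] the first
   term is, elsewhere the second. *)
pose N s := Num.max (k s - 1) (- cos (2 * (s - phi))).
have Nc : continuous N.
  have c1 : continuous (fun s => k s - 1) by move=> s; apply: cvgB; [exact: kc|exact: cvg_cst].
  have c2 : continuous (fun s => - cos (2 * (s - phi))).
    by move=> s; apply: (@deriv_continuous _ _ _ (2 * sin (2 * (s - phi)))); deriv; ring.
  by move=> s; have := continuous_max (c1 s) (c2 s); apply: cvg_trans.
have Npi s : N (s + pi) = N s.
  rewrite /N kpi; have -> : 2 * (s + pi - phi) = 2 * (s - phi) + pi *+ 2 by ring.
  by rewrite cosD2pi.
have [sa [sb Hab]] := periodic_extrema pi0 Npi Nc.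
have Npos : 0 < N sa.
  have Npi' (u : R) : N (u + pi + (phi - pi / 4)) = N (u + (phi - pi / 4)) by rewrite addrAC Npi.
  have [u /andP[u0 u1]] := @periodic_fundamental R (fun u : R => N (u + (phi - pi / 4))) pi
    (sa - (phi - pi / 4)) pi0 Npi'.
  rewrite subrK => <-; set s := u + _.
  have [sl|sl] := leP s (phi + pi / 4).
    rewrite /N lt_max subr_gt0 Hno' //; rewrite sl andbT /s; lra.
  have [su|su] := ltP s (phi + 3 * pi / 4).
    rewrite /N lt_max oppr_gt0; apply/orP; right.
    have -> : 2 * (s - phi) = (2 * (s - phi) - pi) + pi by ring.
    by rewrite cosDpi oppr_lt0; apply: cos_gt0_pihalf; lra.
  have -> : s = phi - pi / 4 + pi by rewrite /s in su *; lra.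
  rewrite Npi /N lt_max subr_gt0 Hno' //; lra.
pose n := Num.min (N sa) 1 / 4.
have n0 : 0 < n by rewrite divr_gt0 // lt_min Npos ltr01.
have n4 : n <= 4^-1 by rewrite /n ler_pdivrMr // mulVf // ge_min lexx orbT.
have nN s : 4 * n <= N s.
  have -> : 4 * n = Num.min (N sa) 1 by rewrite /n; field.
  by rewrite ge_min; have /andP[-> _] := Hab s.
clearbody n.
pose e := 1 - n + 2 * n ^+ 2.
have n2 := sqr_ge0 n.
have e0 : 0 < e by rewrite /e; lra.
have e1 : e <= 1 + n.
  have : n ^+ 2 <= n * 4^-1 by rewrite expr2 ler_pM2l.
  by rewrite /e; lra.
(* Where the first term of [N] is at least [4 n], the larger radius [1 + n] stays
   below [k s]; elsewhere [cos (2 (s - phi)) <= - 4 n] keeps the deformed radius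
   below [1]. *)
have ellipse s : (1 + n) ^+ 2 * cos (s - phi) ^+ 2 + e ^+ 2 * sin (s - phi) ^+ 2 <= k s ^+ 2.
  have X1 := cos2Dsin2 (s - phi).
  have e2 : e ^+ 2 <= (1 + n) ^+ 2 by rewrite ler_pXn2r ?nnegrE //; lra.
  have := nN s; rewrite /N le_max => /orP[] H.
    apply: (@le_trans _ _ ((1 + n) ^+ 2)).
      have : e ^+ 2 * sin (s - phi) ^+ 2 <= (1 + n) ^+ 2 * sin (s - phi) ^+ 2.
        by rewrite ler_wpM2r ?sqr_ge0.
      have : (1 + n) ^+ 2 * cos (s - phi) ^+ 2 + (1 + n) ^+ 2 * sin (s - phi) ^+ 2 = (1 + n) ^+ 2.
        by rewrite -mulrDr X1 mulr1.
      by lra.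
    have ks := k_ge1 s; move: (k s) H ks => ks H ks1.
    by rewrite ler_pXn2r ?nnegrE //; lra.
  apply: (@le_trans _ _ 1); last first.
    by rewrite -[X in X <= _](expr1n _ 2) ler_pXn2r ?nnegrE // ltW.
  have X2 : cos (s - phi) ^+ 2 <= 2^-1 - 2 * n.
    move: H; have -> : 2 * (s - phi) = (s - phi) *+ 2 by ring.
    by rewrite cos_mulr2n; lra.
  have -> : sin (s - phi) ^+ 2 = 1 - cos (s - phi) ^+ 2 by rewrite -X1; ring.
  apply: (@le_trans _ _ (e ^+ 2 + (2^-1 - 2 * n) * ((1 + n) ^+ 2 - e ^+ 2))).
    have : cos (s - phi) ^+ 2 * ((1 + n) ^+ 2 - e ^+ 2) <= (2^-1 - 2 * n) * ((1 + n) ^+ 2 - e ^+ 2).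
      by rewrite ler_wpM2r // subr_ge0.
    by lra.
  rewrite -subr_ge0; have -> : 1 - (e ^+ 2 + (2^-1 - 2 * n) * ((1 + n) ^+ 2 - e ^+ 2))
    = n ^+ 2 * (5 - 6 * n + 6 * n ^+ 2 - 8 * n ^+ 3) by rewrite /e; field.
  rewrite mulr_ge0 //.
  have : n ^+ 3 <= n * 1.
    rewrite exprS ler_pM2l // expr_le1 //; lra.
  by lra.
pose r1' := (1 + n) *: (cos phi *: r1 + sin phi *: r2).
pose r2' := e *: (- sin phi *: r1 + cos phi *: r2).
have := rmax r1' r2'; have -> : cross r1' r2' = (1 + n) * e * d.
  rewrite /r1' /r2' /d -[RHS]mulr1 -(cos2Dsin2 phi) /cross /= /GRing.scale /=; ring.
rewrite leNgt => H; suff : ~~ (d < (1 + n) * e * d).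
  rewrite ltr_pMl // /e => /negP; apply.
  have : 0 < n ^+ 2 * (1 + 2 * n) by rewrite mulr_gt0 ?exprn_gt0 //; lra.
  by lra.
apply: H => u; have [r [s [r0 ->]]] := conj_ellipse_ray u D0.
rewrite supportZ // !dotZl !exprMn -mulrDr ler_wpM2l ?sqr_ge0 //.
apply: le_trans (ellipse s).
have [z1 z2] := dz s.
have zlin (c s' : R) : dot (conj_ellipse p q s) (c *: r1 + s' *: r2) = c * cos s + s' * sin s.
  by rewrite -z1 -z2 /dot /= /GRing.scale /=; ring.
rewrite /r1' /r2' !dotZr !zlin cosB sinB le_eqVlt; apply/orP; left; apply/eqP; ring.
Qed.

End John.

(** * Supporting lines and inverse functions *)

Section Regularity.
Context {R : realType}.
Implicit Types (K : set (plane R)) (p q x y u v : plane R).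

Lemma deriv_fst (g : R -> plane R) (t : R) : derivable g t 1 ->
  is_derive t 1 (fun s => (g s).1) (g^`() t).1.
Proof.
move=> dg.
have H : (fun h : R => h^-1 *: ((g (h *: 1 + t)).1 - (g t).1)) @ 0^' --> (g^`() t).1.
  by rewrite derive1E; apply: (cvg_comp _ (@fst R R) dg); exact: cvg_fst.
apply: DeriveDef; first by apply/cvg_ex; exists (g^`() t).1.
exact: (cvg_lim (@norm_hausdorff _ _) H).
Qed.

Lemma deriv_snd (g : R -> plane R) (t : R) : derivable g t 1 ->
  is_derive t 1 (fun s => (g s).2) (g^`() t).2.
Proof.
move=> dg.
have H : (fun h : R => h^-1 *: ((g (h *: 1 + t)).2 - (g t).2)) @ 0^' --> (g^`() t).2.
  by rewrite derive1E; apply: (cvg_comp _ (@snd R R) dg); exact: cvg_snd.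
apply: DeriveDef; first by apply/cvg_ex; exists (g^`() t).2.
exact: (cvg_lim (@norm_hausdorff _ _) H).
Qed.

Lemma normr_cos (t : R) : `|cos t| <= 1.
Proof. by rewrite ler_norml cos_geN1 cos_le1. Qed.

Lemma normr_sin (t : R) : `|sin t| <= 1.
Proof. by rewrite ler_norml sin_geN1 sin_le1. Qed.

Lemma compact_coord_bound K : compact K -> K !=set0 ->
  exists2 b : R, 0 <= b & forall x, K x -> `|x.1| <= b /\ `|x.2| <= b.
Proof.
move=> cK K0; pose f x := dot x x.
have fc : continuous f.
  by move=> x; apply: cvgD; apply: cvgM; (exact: fst_cont || exact: snd_cont).
have [c _ Hc] := compact_EVT_max K0 cK (continuous_subspaceT fc).
exists (Num.sqrt (f c)); first exact: sqrtr_ge0.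
move=> x Kx; have : f x <= f c by apply: Hc; rewrite inE.
rewrite /f (dot_sqr x) => H; have x1 := sqr_ge0 x.1; have x2 := sqr_ge0 x.2.
by split; rewrite -sqrtr_sqr ler_sqrt ?dot_ge0 //; lra.
Qed.

(** The functions [dot x o circle] with [x] in [K] are equicontinuous, as [K] is
    bounded. *)
Lemma support_circle_continuous K : compact K -> K !=set0 ->
  continuous (fun t => support_fun K (circle t)).
Proof.
move=> cK K0 t; have [b b0 Hb] := compact_coord_bound cK K0.
pose d s := b * (`|cos s - cos t| + `|sin s - sin t|).
have le1 s s' : support_fun K (circle s) <=
    support_fun K (circle s') + b * (`|cos s - cos s'| + `|sin s - sin s'|).
  apply: support_le => // x Kx.
  have := support_ub (circle s') cK Kx; have [x1 x2] := Hb x Kx.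
  have -> : dot x (circle s) = dot x (circle s') +
      (x.1 * (cos s - cos s') + x.2 * (sin s - sin s')).
    by rewrite /dot /=; ring.
  move=> H; apply: lerD => //; rewrite [X in _ <= X]mulrDr.
  by apply: lerD; apply: le_trans (ler_norm _) _; rewrite normrM ler_wpM2r.
have dt : d @ t --> 0.
  have -> : 0 = b * (`|cos t - cos t| + `|sin t - sin t|) by rewrite !subrr normr0 addr0 mulr0.
  apply: cvgM; first exact: cvg_cst.
  apply: cvgD; apply: cvg_norm; apply: cvgB; try exact: cvg_cst.
    exact: continuous_cos.
  exact: continuous_sin.
apply: (@squeeze_cvgr _ _ _ _ (fun s => support_fun K (circle t) - d s)
  (fun s => support_fun K (circle t) + d s)).
- apply: nearW => s; rewrite /d le1 andbT lerBlDr.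
  by have := le1 t s; rewrite (distrC (cos t)) (distrC (sin t)).
- by rewrite -[X in _ --> X]subr0; apply: cvgB => //; exact: cvg_cst.
- by rewrite -[X in _ --> X]addr0; apply: cvgD => //; exact: cvg_cst.
Qed.

(** If [x] were strictly below [K] in every direction, the gap would have a
    positive minimum over the circle, and a neighbourhood of [x] would satisfy
    all the inequalities that define [K]. *)
Lemma supporting_line K x : compact K -> convex_set (K : set (convex_lmodType (plane R))) ->
  boundary K x -> exists t, forall y, K y -> dot y (circle t) <= dot x (circle t).
Proof.
move=> cK vK [clx nint].
have Kcl : closed K by apply: compact_closed => //; exact: norm_hausdorff.
have Kx : K x by rewrite ((closure_id K).1 Kcl).
have K0 : K !=set0 by exists x.
pose f t := support_fun K (circle t) - dot x (circle t).
have fc : continuous f.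
  move=> t; apply: cvgB; first exact: support_circle_continuous.
  by apply: cvgD; apply: cvgM; (exact: cvg_cst || exact: continuous_cos || exact: continuous_sin).
have fper t : f (t + pi *+ 2) = f t by rewrite /f /circle cosD2pi sinD2pi.
have pi2 : 0 < pi *+ 2 :> R by rewrite mulrn_wgt0 // pi_gt0.
have [t [tb Hab]] := periodic_extrema pi2 fper fc.
exists t => y Ky; apply: (le_trans (support_ub _ cK Ky)).
rewrite leNgt -subr_gt0 -/(f t); apply/negP => ft; apply: nint.
apply/nbhs_ballP; exists (f t / 2) => /=; first by rewrite divr_gt0.
move=> w [w1 w2]; apply: support_separation => // u.
have [s ->] := polar_plane u; rewrite supportZ ?sqrtr_ge0 // dotZr ler_wpM2l ?sqrtr_ge0 //.
have /andP[fs _] := Hab s.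
have -> : dot w (circle s) = dot x (circle s) - ((x.1 - w.1) * cos s + (x.2 - w.2) * sin s).
  by rewrite /dot /=; ring.
have e1 : `|(x.1 - w.1) * cos s| <= f t / 2.
  rewrite normrM -[X in _ <= X]mulr1; apply: ler_pM => //; [exact: ltW|exact: normr_cos].
have e2 : `|(x.2 - w.2) * sin s| <= f t / 2.
  rewrite normrM -[X in _ <= X]mulr1; apply: ler_pM => //; [exact: ltW|exact: normr_sin].
move: e1 e2; rewrite !ler_norml => /andP[e1 _] /andP[e2 _].
by move: fs; rewrite {2}/f; lra.
Qed.

(** The lower bound on the derivative makes [nu] unbounded in both directions. *)
Lemma increasing_inverse (nu w : R -> R) (c : R) : 0 < c ->
  (forall s : R, is_derive s 1 nu (w s)) -> (forall s, c <= w s) ->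
  exists sg : R -> R, cancel sg nu /\ forall t : R, is_derive t 1 sg (w (sg t))^-1.
Proof.
move=> c0 Hnu wc.
have nuc : continuous nu by move=> s; apply: deriv_continuous.
have w0 s : 0 < w s by apply: lt_le_trans (wc s).
have inc s s' : s < s' -> nu s < nu s'.
  by move=> ss; apply: (@deriv_gt0_lt _ nu w).
have inj : injective nu.
  move=> s s' E; case: (ltgtP s s') => // /inc; by rewrite E ltxx.
have lin s : 0 <= s -> nu (- s) <= nu 0 - c * s /\ nu 0 + c * s <= nu s.
  move=> s0; pose D (z : R) := nu z - c * z; pose D1 (z : R) := w z - c.
  have HD (z : R) : is_derive z 1 D (D1 z) by rewrite /D /D1; deriv; ring.
  have mono a b : a <= b -> nu a - c * a <= nu b - c * b.
    move=> ab; apply: (@deriv_ge0_le _ D D1) => // z _.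
    by rewrite subr_ge0.
  have := mono 0 s s0; have := mono (- s) 0; rewrite oppr_le0 => /(_ s0).
  by split; lra.
have surj t : exists s, nu s = t.
  pose L := `|t - nu 0| / c.
  have L0 : 0 <= L by rewrite divr_ge0 // ltW.
  have cL : c * L = `|t - nu 0| by rewrite /L mulrC divfK // gt_eqF.
  have [l1 l2] := lin L L0.
  have n1 := ler_norm (t - nu 0); have n2 := lerNnormlW (lexx `|t - nu 0|).
  have [|||s _ <-] := @IVT R nu (- L) L t.
  - by lra.
  - exact: continuous_within.
  - by rewrite ge_min le_max; apply/andP; split; apply/orP; [left|right]; lra.
  by exists s.
have [sg Hsg] := @choice _ _ _ surj.
exists sg; split=> // t.
have can : cancel nu sg by move=> s; apply: inj; rewrite Hsg.
rewrite -[X in is_derive X](Hsg t).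
apply: is_derive_inverse; last by rewrite gt_eqF.
- by near=> s; exact: can.
- by near=> s; exact: nuc.
Unshelve. all: by end_near.
Qed.

End Regularity.

(** * Regularity of the support function *)

Section SupportPinched.
Context {R : realType}.
Implicit Types (K : set (plane R)).

Lemma periodic_deriv1 (V : normedModType R) (g : R -> V) (T : R) :
  (forall t, g (t + T) = g t) -> forall t, g^`() (t + T) = g^`() t.
Proof.
move=> gT t.
have E : (fun h : R => h^-1 *: (g (h + (t + T)) - g (t + T))) =
    (fun h : R => h^-1 *: (g (h + t) - g t)) by apply/funext => h; rewrite addrA !gT.
by rewrite /derive1 E.
Qed.

Lemma support_circle_gt0 K : compact K -> K° 0 ->
  forall t, 0 < support_fun K (circle t).
Proof.
move=> cK /nbhs_ballP[e /= e0 He] t.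
have e2 : 0 < e / 2 by rewrite divr_gt0.
have Kx : K ((e / 2) *: circle t).
  apply: He; split; rewrite /ball /= sub0r normrN normrM gtr0_norm //.
    by apply: (@le_lt_trans _ _ (e / 2 * 1)); [rewrite ler_wpM2l ?normr_cos // ltW|lra].
  by apply: (@le_lt_trans _ _ (e / 2 * 1)); [rewrite ler_wpM2l ?normr_sin // ltW|lra].
by apply: lt_le_trans (support_ub _ cK Kx); rewrite dotZl dot_circle mulr1.
Qed.

(** The outer normal [(b1, - a1)] has an angle [nu] with derivative
    [w = X / N > 0], so [nu] has a differentiable inverse [sg].  By the
    supporting line at [(a s, b s)] the support function at [nu s] is attained
    there, so [h = a (sg t) cos t + b (sg t) sin t].  The velocity is orthogonal
    to the normal, so [h'] involves no derivative of [sg] and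
    [h'' + h = sqrt N / w = N^(3/2) / X], the radius of curvature.  Thus [h^3 f]
    is a periodic function of the parameter of the curve, which bounds it. *)
Lemma support_of_curve K (a b a1 b1 a2 b2 : R -> R) (T : R) :
  compact K -> K° 0 -> 0 < T ->
  (forall s : R, is_derive s 1 a (a1 s)) -> (forall s : R, is_derive s 1 b (b1 s)) ->
  (forall s : R, is_derive s 1 a1 (a2 s)) -> (forall s : R, is_derive s 1 b1 (b2 s)) ->
  continuous a2 -> continuous b2 ->
  (forall s, [/\ a (s + T) = a s, b (s + T) = b s, a1 (s + T) = a1 s & b1 (s + T) = b1 s]) ->
  (forall s, a2 (s + T) = a2 s /\ b2 (s + T) = b2 s) ->
  (forall s, 0 < a1 s ^+ 2 + b1 s ^+ 2) ->
  (forall s, 0 < a1 s * b2 s - b1 s * a2 s) ->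
  (forall s, K (a s, b s)) ->
  (forall s, exists t, forall y, K y -> dot y (circle t) <= dot (a s, b s) (circle t)) ->
  exists (sg psi : R -> R) (h1 h2 : R -> R),
    [/\ (forall s, psi (s + T) = psi s), continuous psi,
      (forall t : R, is_derive t 1 (fun t => support_fun K (circle t)) (h1 t)),
      (forall t : R, is_derive t 1 h1 (h2 t))
    & forall t, 0 < support_fun K (circle t) /\ 0 < psi t /\
       support_fun K (circle t) ^+ 3 * (h2 t + support_fun K (circle t)) = psi (sg t)].
Proof.
move=> cK K00 T0 Ha Hb Ha1 Hb1 a2c b2c T1 T2 N_gt0 X_gt0 bdK sline.
have K0 : K !=set0 by exists (a 0, b 0).
have ac : continuous a by move=> s; apply: deriv_continuous.
have bc : continuous b by move=> s; apply: deriv_continuous.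
have a1c : continuous a1 by move=> s; apply: deriv_continuous.
have b1c : continuous b1 by move=> s; apply: deriv_continuous.
pose N s := a1 s ^+ 2 + b1 s ^+ 2.
pose X s := a1 s * b2 s - b1 s * a2 s.
have N0 s : 0 < N s by exact: N_gt0.
have X0 s : 0 < X s by exact: X_gt0.
have Nn s : N s != 0 by rewrite gt_eqF.
have Xn s : X s != 0 by rewrite gt_eqF.
have HNa1 (s : R) : is_derive s 1 (fun s => - a1 s) (- a2 s) by deriv.
have Na2c : continuous (fun s => - a2 s) by move=> s; apply: cvgN; exact: a2c.
have N0' s : 0 < b1 s ^+ 2 + (- a1 s) ^+ 2 by rewrite sqrrN addrC; exact: N0.
have [nu Hnu] := angle_lift Hb1 HNa1 b2c Na2c N0'.
pose r s := Num.sqrt (N s).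
have r0 s : 0 < r s by rewrite sqrtr_gt0.
have rn s : r s != 0 by rewrite gt_eqF.
have r2 s : r s ^+ 2 = N s by rewrite sqr_sqrtr // ltW.
pose w s := X s / N s.
have Dnu (s : R) : is_derive s 1 nu (w s).
  have [H _ _] := Hnu s; apply: deriv_eq H _; rewrite /w /X /N.
  by congr (_ / _); ring.
have nuE s : b1 s = r s * cos (nu s) /\ a1 s = - (r s * sin (nu s)).
  have [_] := Hnu s; rewrite sqrrN addrC -/(N s) -/(r s) => E1 E2.
  by split=> //; rewrite -E2 opprK.
(* The normal of a supporting line is [+-] the lifted normal, because the velocity
   is orthogonal to it; positive curvature and maximality decide the sign. *)
have supp s : support_fun K (circle (nu s)) = a s * cos (nu s) + b s * sin (nu s).
  have [t Ht] := sline s.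
  pose f u := a u * cos t + b u * sin t.
  pose f1 u := a1 u * cos t + b1 u * sin t.
  have fmax u : f u <= f s by exact: Ht (bdK u).
  have Hf (u : R) : is_derive u 1 f (f1 u) by rewrite /f /f1; deriv; ring.
  have Hf1 (u : R) : is_derive u 1 f1 (a2 u * cos t + b2 u * sin t).
    by rewrite /f1; deriv; ring.
  have f10 : f1 s = 0 := deriv_at_max fmax Hf.
  have f20 := deriv2_at_max fmax Hf (Hf1 s).
  have [b1E a1E] := nuE s.
  (* [C] and the left-hand side of [S0] are the cosine and sine of [t - nu s]. *)
  pose C := cos t * cos (nu s) + sin t * sin (nu s).
  have S0 : sin t * cos (nu s) - cos t * sin (nu s) = 0.
    apply: (mulfI (rn s)); rewrite mulr0 -[RHS]f10 /f1 a1E b1E; ring.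
  have cs := cos2Dsin2 (nu s); have cst := cos2Dsin2 t.
  have ct : cos t = C * cos (nu s).
    transitivity (cos t * (cos (nu s) ^+ 2 + sin (nu s) ^+ 2)); first by rewrite cs mulr1.
    transitivity (C * cos (nu s) - (sin t * cos (nu s) - cos t * sin (nu s)) * sin (nu s)).
      by rewrite /C; ring.
    by rewrite S0 mul0r subr0.
  have st : sin t = C * sin (nu s).
    transitivity (sin t * (cos (nu s) ^+ 2 + sin (nu s) ^+ 2)); first by rewrite cs mulr1.
    transitivity (C * sin (nu s) + (sin t * cos (nu s) - cos t * sin (nu s)) * cos (nu s)).
      by rewrite /C; ring.
    by rewrite S0 mul0r addr0.
  have C2 : C ^+ 2 = 1.
    by rewrite -cst ct st !exprMn -mulrDr cs mulr1.
  have C0 : 0 <= C.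
    rewrite leNgt; apply/negP => Cneg.
    have : 0 < r s * (a2 s * cos t + b2 s * sin t).
      have -> : r s * (a2 s * cos t + b2 s * sin t) = - C * X s.
        by rewrite /X a1E b1E ct st; ring.
      by rewrite mulr_gt0 ?oppr_gt0.
    by rewrite pmulr_rgt0 // ltNge f20.
  have C1 : C = 1.
    by apply/eqP; rewrite -(@eqrXn2 _ 2) // ?ler01 // C2 expr1n.
  have E : circle t = circle (nu s) by rewrite /circle ct st C1 !mul1r.
  apply/eqP; rewrite eq_le; apply/andP; split.
    have -> : a s * cos (nu s) + b s * sin (nu s) = dot (a s, b s) (circle t) by rewrite E.
    by rewrite -E; apply: support_le => // x Kx; exact: Ht.
  exact: (support_ub (circle (nu s)) cK (bdK s)).
have wT s : w (s + T) = w s by rewrite /w /X /N; have [_ _ -> ->] := T1 s; have [-> ->] := T2 s.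
have Nc : continuous N by move=> s; apply: cvgD; apply: cvgM; (exact: a1c || exact: b1c).
have Xc : continuous X.
  by move=> s; apply: cvgB; apply: cvgM; [exact: a1c|exact: b2c|exact: b1c|exact: a2c].
have wc : continuous w.
  by move=> s; apply: cvgM; [exact: Xc|apply: cvgV; [exact: Nn|exact: Nc]].
have w0 s : 0 < w s by rewrite divr_gt0.
have [wa [wb Hw]] := periodic_extrema T0 wT wc.
have [|sg [sgK Dsg]] := increasing_inverse (w0 wa) Dnu.
  by move=> s; have /andP[] := Hw s.
pose psi s := (a s * b1 s - b s * a1 s) ^+ 3 / X s.
pose h t := support_fun K (circle t).
have hE t : h t = a (sg t) * cos t + b (sg t) * sin t.
  by rewrite /h -{1}(sgK t) supp sgK.
pose h1 t := - a (sg t) * sin t + b (sg t) * cos t.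
pose h2 t := r (sg t) / w (sg t) - h t.
have tE t : b1 (sg t) = r (sg t) * cos t /\ a1 (sg t) = - (r (sg t) * sin t).
  by have := nuE (sg t); rewrite sgK.
have Dh (t : R) : is_derive t 1 h (h1 t).
  have -> : h = (fun t => a (sg t) * cos t + b (sg t) * sin t) by apply/funext.
  have wn : w (sg t) != 0 by rewrite gt_eqF.
  have [E1 E2] := tE t.
  by deriv; rewrite /h1 E1 E2; field.
have Dh1 (t : R) : is_derive t 1 h1 (h2 t).
  have wn : w (sg t) != 0 by rewrite gt_eqF.
  have [E1 E2] := tE t.
  rewrite /h1 /h2 hE; deriv; rewrite E1 E2.
  transitivity (r (sg t) / w (sg t) * (cos t ^+ 2 + sin t ^+ 2)
    - (a (sg t) * cos t + b (sg t) * sin t)); first by field.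
  by rewrite cos2Dsin2 mulr1.
have h0 := support_circle_gt0 cK K00.
have psiE t : h t ^+ 3 * (h2 t + h t) = psi (sg t).
  rewrite /h2 subrK /psi; have [E1 E2] := tE t.
  have -> : a (sg t) * b1 (sg t) - b (sg t) * a1 (sg t) = r (sg t) * h t.
    by rewrite E1 E2 hE; ring.
  have Xt := Xn (sg t); have Nt := Nn (sg t).
  rewrite /w exprMn; have -> : r (sg t) ^+ 3 = r (sg t) * N (sg t) by rewrite -r2 -exprS.
  by field; rewrite Xt Nt.
exists sg, psi, h1, h2; split=> //.
- by move=> s; rewrite /psi /X; have [-> -> -> ->] := T1 s; have [-> ->] := T2 s.
- move=> s; apply: cvgM; last by apply: cvgV; [exact: Xn|exact: Xc].
  have c1 : continuous (fun s => a s * b1 s - b s * a1 s).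
    by move=> u; apply: cvgB; apply: cvgM; [exact: ac|exact: b1c|exact: bc|exact: a1c].
  apply: (@continuous_comp _ _ _ (fun s => a s * b1 s - b s * a1 s) (fun x => x ^+ 3)).
    exact: c1.
  exact: exprn_continuous.
move=> t; split; first exact: h0.
split; last exact: psiE.
have [E1 E2] := nuE t; rewrite /psi divr_gt0 // exprn_gt0 //.
have -> : a t * b1 t - b t * a1 t = r t * h (nu t).
  by rewrite /h supp E1 E2; ring.
by rewrite mulr_gt0 //; exact: h0.
Qed.

Lemma gauss_parametrization K : F02 K ->
  exists (sg psi : R -> R) (h1 h2 : R -> R) (T : R),
    [/\ 0 < T /\ (forall s, psi (s + T) = psi s), continuous psi,
      (forall t : R, is_derive t 1 (fun t => support_fun K (circle t)) (h1 t)),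
      (forall t : R, is_derive t 1 h1 (h2 t))
    & forall t, 0 < support_fun K (circle t) /\ 0 < psi t /\
       support_fun K (circle t) ^+ 3 * (h2 t + support_fun K (circle t)) = psi (sg t)].
Proof.
move=> [[cK vK _] [g [T [gsm [T0 gT _ g1n] gK curv]]] K00].
pose g1 := g^`(); pose g2 := g^`(2).
have g2E : g2 = g1^`() by rewrite /g2 derive1nS derive1n1.
pose a s := (g s).1; pose b s := (g s).2.
pose a1 s := (g1 s).1; pose b1 s := (g1 s).2.
pose a2 s := (g2 s).1; pose b2 s := (g2 s).2.
have Ha (s : R) : is_derive s 1 a (a1 s) by exact: deriv_fst (gsm 0%N s).
have Hb (s : R) : is_derive s 1 b (b1 s) by exact: deriv_snd (gsm 0%N s).
have dg1 s : derivable g1 s 1 by have := gsm 1%N s; rewrite derive1n1.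
have Ha1 (s : R) : is_derive s 1 a1 (a2 s) by rewrite /a2 g2E; exact: deriv_fst.
have Hb1 (s : R) : is_derive s 1 b1 (b2 s) by rewrite /b2 g2E; exact: deriv_snd.
have a2c : continuous a2 by move=> s; apply: deriv_continuous (deriv_fst (gsm 2%N s)).
have b2c : continuous b2 by move=> s; apply: deriv_continuous (deriv_snd (gsm 2%N s)).
have g1T s : g1 (s + T) = g1 s by exact: periodic_deriv1.
have g2T s : g2 (s + T) = g2 s by rewrite g2E; exact: periodic_deriv1.
have N0 s : 0 < a1 s ^+ 2 + b1 s ^+ 2 by have := dot_gt0 (g1n s).
have X0 s : 0 < a1 s * b2 s - b1 s * a2 s.
  have := curv s; rewrite /curvature pmulr_lgt0 //.
  by rewrite invr_gt0 exprn_gt0 // sqrtr_gt0 dot_gt0.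
have bd s : boundary K (g s) by rewrite -gK; exists s.
have Kcl : closed K by apply: compact_closed => //; exact: norm_hausdorff.
have bdK s : K (a s, b s).
  rewrite /a /b -surjective_pairing; have [+ _] := bd s.
  by rewrite -((closure_id K).1 Kcl).
have sline s : exists t, forall y, K y -> dot y (circle t) <= dot (a s, b s) (circle t).
  by have := supporting_line cK vK (bd s); rewrite /a /b -surjective_pairing.
have T1 s : [/\ a (s + T) = a s, b (s + T) = b s, a1 (s + T) = a1 s & b1 (s + T) = b1 s].
  by rewrite /a /b /a1 /b1 gT g1T.
have T2 s : a2 (s + T) = a2 s /\ b2 (s + T) = b2 s by rewrite /a2 /b2 g2T.
have [sg [psi [h1 [h2 [psiT psic Dh Dh1 H]]]]] :=
  support_of_curve cK K00 T0 Ha Hb Ha1 Hb1 a2c b2c T1 T2 N0 X0 bdK sline.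
by exists sg, psi, h1, h2, T.
Qed.

(** [h^3 f] is a continuous periodic positive function of the curve parameter,
    so its infimum is positive and its supremum finite. *)
Lemma F02_pinched K : F02 K -> exists (m M : R) (h1 h2 : R -> R),
  [/\ 0 < m, Rm2 K = M / m &
     pinched m M (fun t => support_fun K (circle t)) h1 h2].
Proof.
move=> /gauss_parametrization[sg [psi [h1 [h2 [T [[T0 psiT] psic Dh Dh1 H]]]]]].
have E : h3f K = (fun t => psi (sg t)).
  apply/funext => t; have [_ [_ <-]] := H t.
  rewrite /h3f /curvature_fun; congr (_ * (_ + _)).
  have e1 : (support_fun K \o @circle R)^`() = h1.
    by apply/funext => u; rewrite derive1E; have [_ <-] := Dh u.
  by rewrite derive1nS derive1n1 e1 derive1E; have [_ <-] := Dh1 t.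
have [sa [sb Hab]] := periodic_extrema T0 psiT psic.
have mP t : psi sa <= psi (sg t) by have /andP[] := Hab (sg t).
have MP t : psi (sg t) <= psi sb by have /andP[] := Hab (sg t).
have lb : has_lbound (range (h3f K)) by exists (psi sa) => _ [t _ <-]; rewrite E.
have ub : has_ubound (range (h3f K)) by exists (psi sb) => _ [t _ <-]; rewrite E.
have ne : range (h3f K) !=set0 by exists (h3f K 0), 0.
exists (inf (range (h3f K))), (sup (range (h3f K))), h1, h2; split=> //.
- apply: (@lt_le_trans _ _ (psi sa)).
    by have [_ []] := H sa.
  by apply: lb_le_inf => // _ [t _ <-]; rewrite E.
move=> t; have [h0 [_ pE]] := H t; split=> //.
rewrite pE; have -> : psi (sg t) = h3f K t by rewrite E.
by apply/andP; split; [apply: ge_inf|apply: ub_le_sup] => //; exists t.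
Qed.

End SupportPinched.

(** * Stability *)

Section Stability.
Context {R : realType}.
Implicit Types (K : set (plane R)).

Lemma F02_convex_compact K : F02 K -> [/\ compact K,
  convex_set (K : set (convex_lmodType (plane R))) & K !=set0].
Proof.
by move=> [[cK vK [x Kx]] _ _]; split=> //; exists x; exact: interior_subset.
Qed.

Lemma conj_ellipse_periodic (p q : plane R) s :
  conj_ellipse p q (s + pi *+ 2) = conj_ellipse p q s.
Proof. by rewrite /conj_ellipse cosD2pi sinD2pi. Qed.

Lemma Rm2_ge1 K : F02 K -> 1 <= Rm2 K.
Proof.
move=> /F02_pinched[m [M [h1 [h2 [m0 -> Hp]]]]].
by have [_ _ _ /andP[p1 p2]] := Hp 0; rewrite ler_pdivlMr // mul1r (le_trans p1).
Qed.

(** With [e = Rm2 K - 1] and [r = 8 sqrt e <= 1/2], the normalized support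
    function lies in [1 - r, 1 + r], whence d_BM - 1 is at most [4 r] and its
    fourth power at most [256 r^4 = 2^20 e^2 <= 4096 e]. *)
Lemma banach_mazur_stability K : F02 K -> Rm2 K <= 1 + 256^-1 ->
  (banach_mazur K (@unit_disc R) - 1) ^+ 4 <= 4096 * (Rm2 K - 1).
Proof.
move=> FK; have R1 := Rm2_ge1 FK.
have [cK vK K0] := F02_convex_compact FK.
have [m [M [h1 [h2 [m0 RE Hp]]]]] := F02_pinched FK.
move=> Rle; set e := Rm2 K - 1.
have pi2 : 0 < pi *+ 2 :> R by rewrite mulrn_wgt0 // pi_gt0.
set h := fun t => support_fun K (circle t) in Hp.
have Dh (t : R) : is_derive t 1 h (h1 t) by have [] := Hp t.
have hc : continuous h by move=> t; apply: deriv_continuous.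
have hper t : h (t + pi *+ 2) = h t by rewrite /h /circle cosD2pi sinD2pi.
have [ta [t0 Hab]] := periodic_extrema pi2 hper hc.
have hmax t : h t <= h t0 by have /andP[] := Hab t.
pose H := h t0.
have H0 : 0 < H by have [] := Hp t0.
have Hn : H != 0 by rewrite gt_eqF.
have sm0 : 0 < Num.sqrt m by rewrite sqrtr_gt0.
have smn : Num.sqrt m != 0 by rewrite gt_eqF.
(* The determinant [1 / sqrt m] makes the lower pinching bound 1, and the length
   of [p] makes [k 0 = 1]. *)
pose p := H^-1 *: circle t0; pose q := (H / Num.sqrt m) *: circle (t0 + pi / 2).
have cq : circle (t0 + pi / 2) = (- sin t0, cos t0).
  by rewrite /circle cosDpihalf sinDpihalf.
have D : cross p q = (Num.sqrt m)^-1.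
  rewrite /p /q cq /cross /= /GRing.scale /=.
  transitivity ((cos t0 ^+ 2 + sin t0 ^+ 2) * (Num.sqrt m)^-1); first by field; rewrite Hn smn.
  by rewrite cos2Dsin2 mul1r.
have D0 : 0 < cross p q by rewrite D invr_gt0.
have D2 : cross p q ^+ 2 = m^-1 by rewrite D exprVn sqr_sqrtr // ltW.
have [th [k1 [k2 [Hk zE k1E]]]] := pinched_transform cK K0 D0 Hp.
set k := fun s => support_fun K (conj_ellipse p q s) in Hk.
have z0 : conj_ellipse p q 0 = p by rewrite /conj_ellipse cos0 sin0 scale1r scale0r addr0.
have zpi : conj_ellipse p q (0 + pi / 2) = q.
  by rewrite add0r /conj_ellipse cos_pihalf sin_pihalf scale1r scale0r add0r.
have HV0 : 0 <= H^-1 by rewrite invr_ge0 ltW.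
have k0 : k 0 = 1 by rewrite /k z0 /p supportZ // mulVf.
have ep : enorm p = H^-1.
  by rewrite /enorm /p dotZl dotZr dot_circle mulr1 -expr2 sqrtr_sqr ger0_norm.
have hth : h (th 0) = H.
  move: k0; rewrite /k zE z0 ep supportZ // => E.
  by rewrite -[LHS](mulVKf Hn) E mulr1.
have h1th : h1 (th 0) = 0.
  by apply: (@deriv_at_max _ h) => // s; rewrite hth.
have k10 : k1 0 = 0.
  have := k1E 0; rewrite zpi z0 h1th mul0r addr0 ep.
  have -> : dot p q = 0 by rewrite /p /q cq dotZl dotZr /dot /=; ring.
  by rewrite mul0r => /eqP; rewrite mulf_eq0 invr_eq0 (negPf Hn) => /eqP.
have e0 : 0 <= e by rewrite subr_ge0.
have e1 : e <= 256^-1 by rewrite /e; lra.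
have Hk' : pinched 1 (1 + e) k k1 k2.
  have -> : 1 = cross p q ^+ 2 * m by rewrite D2 mulVf // gt_eqF.
  have -> // : cross p q ^+ 2 * m + e = cross p q ^+ 2 * M.
  rewrite D2 mulVf ?gt_eqF // /e RE mulrC; ring.
have kper s : k (s + pi *+ 2) = k s by rewrite /k conj_ellipse_periodic.
have kb s : (k s - 1) ^+ 2 <= 64 * e.
  have [u /andP[u0 u1] <-] := periodic_fundamental s pi2 kper.
  apply: (pinched_near_constant Hk' _ k0 k10); first lra.
  by rewrite u0 add0r /=; have := @pihalf_lt2 R; move: u1; rewrite -mulr_natr; lra.
pose r := 8 * Num.sqrt e.
have r0 : 0 <= r by rewrite mulr_ge0 ?sqrtr_ge0.
have r2 : r ^+ 2 = 64 * e by rewrite exprMn sqr_sqrtr //; ring.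
have rhalf : r <= 2^-1.
  rewrite -(@ler_pXn2r _ 2) ?nnegrE // ?invr_ge0 // r2.
  have -> : 2^-1 ^+ 2 = 64 * 256^-1 :> R by field.
  by rewrite ler_pM2l.
have kr s : 1 - r <= k s <= 1 + r.
  have : `|k s - 1| <= r.
    rewrite -(@ler_pXn2r _ 2) ?nnegrE //.
    by rewrite real_normK ?num_real // r2.
  by rewrite ler_norml; lra.
have c10 : 0 < 1 - r by lra.
have /andP[d1 d2] := banach_mazur_bounds cK vK K0 D0 c10 kr.
set d := banach_mazur _ _ in d1 d2 *.
have d4 : d - 1 <= 4 * r.
  have : (1 + r) / (1 - r) <= 1 + 4 * r.
    rewrite ler_pdivrMr //.
    have : 0 <= r * (2^-1 - r) by rewrite mulr_ge0 // subr_ge0.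
    by lra.
  by lra.
apply: (@le_trans _ _ ((4 * r) ^+ 4)).
  by rewrite ler_pXn2r ?nnegrE //; [lra | rewrite mulr_ge0].
have -> : (4 * r) ^+ 4 = 256 * (r ^+ 2) ^+ 2 by ring.
rewrite r2; have : e * e <= e * 256^-1 by rewrite ler_wpM2l.
by lra.
Qed.

(** After normalization by a maximal inscribed ellipse the pinching interval is
    [D^2 m, D^2 M] with [D^2 m <= 1], and [k^2 <= D^2 M <= M / m]. *)
Lemma banach_mazur_symmetric K : F02 K -> origin_symmetric K ->
  banach_mazur K (@unit_disc R) <= Num.sqrt (Rm2 K).
Proof.
move=> FK sK.
have [cK vK K0] := F02_convex_compact FK.
have [m [M [h1 [h2 [m0 RE Hp]]]]] := F02_pinched FK.
have Hsym u : support_fun K (- u) = support_fun K u.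
  rewrite /support_fun; congr sup; apply/seteqP; split => _ [x Kx <-] /=.
    exists (- x); last by rewrite /dot /=; ring.
    by rewrite sK; exists x.
  exists (- x); last by rewrite /dot /=; ring.
  by rewrite sK; exists x.
have [p [q [D0 k_ge1 contact]]] := john_position cK K0 Hp Hsym.
have [th [k1 [k2 [Hk _ _]]]] := pinched_transform cK K0 D0 Hp.
have m1 := pinched_contact_le1 Hk k_ge1 contact.
have [s0 [_ ks0]] := contact 0.
have pi2 : 0 < pi *+ 2 :> R by rewrite mulrn_wgt0 // pi_gt0.
have kper s : support_fun K (conj_ellipse p q (s + pi *+ 2)) = support_fun K (conj_ellipse p q s).
  by rewrite conj_ellipse_periodic.
have [M1 kM] := pinched_upper Hk pi2 kper k_ge1 ks0.
have D2 : 0 < cross p q ^+ 2 by rewrite exprn_gt0.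
have M0 : 0 < M by rewrite -(pmulr_rgt0 _ D2); lra.
have DM : cross p q ^+ 2 * M <= Rm2 K.
  rewrite RE ler_pdivlMr // mulrAC -[X in _ <= X]mul1r.
  by rewrite ler_wpM2r // ltW.
have kb s : 1 <= support_fun K (conj_ellipse p q s) <= Num.sqrt (Rm2 K).
  rewrite k_ge1 /=; have k0 : 0 <= support_fun K (conj_ellipse p q s) by apply: le_trans (k_ge1 s).
  rewrite -(ger0_norm k0) -sqrtr_sqr ler_sqrt ?(le_trans (kM s)) //.
  by apply: le_trans (Rm2_ge1 FK).
have /andP[_] := banach_mazur_bounds cK vK K0 D0 ltr01 kb.
by rewrite divr1.
Qed.

End Stability.

Theorem theorem1p5 (R : realType) :
  (exists gamma delta : R,
    [/\ 0 < gamma,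
        0 < delta,
        (forall K : set (plane R),
          F02 K -> Rm2 K <= 1 + delta ->
          (banach_mazur K (@unit_disc R) - 1) ^+ 4 <= gamma * (Rm2 K - 1))
      & (forall K : set (plane R),
          F02 K -> Rm2 K <= 1 + delta -> is_santalo_point K 0 ->
          (banach_mazur K (@unit_disc R) - 1) ^+ 4
            <= gamma * (Num.sqrt (Rm2 K) - 1))])
  /\ (forall K : set (plane R),
       F02 K -> origin_symmetric K ->
       banach_mazur K (@unit_disc R) <= Num.sqrt (Rm2 K)).
Proof.
split; last by move=> K; exact: banach_mazur_symmetric.
(* The factor [3] is for the second bound: [R - 1 <= 3 (sqrt R - 1)], as
   [sqrt R <= 2]. *)
exists (3 * 4096), 256^-1; split; [lra|lra| |] => K FK Rle.
  have R1 := Rm2_ge1 FK; have := banach_mazur_stability FK Rle; lra.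
move=> _; apply: (le_trans (banach_mazur_stability FK Rle)).
have R1 := Rm2_ge1 FK.
have sR : Num.sqrt (Rm2 K) ^+ 2 = Rm2 K by rewrite sqr_sqrtr //; lra.
have s1 : 1 <= Num.sqrt (Rm2 K) by rewrite -[X in X <= _]sqrtr1 ler_sqrt //; lra.
have s2 : Num.sqrt (Rm2 K) <= 2.
  by rewrite -(@ler_pXn2r _ 2) ?nnegrE ?sqrtr_ge0 // sR; lra.
rewrite -{1}sR; have : 0 <= (Num.sqrt (Rm2 K) - 1) * (2 - Num.sqrt (Rm2 K)).
  by rewrite mulr_ge0 ?subr_ge0.
by lra.
Qed.
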